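(* For any finite poset $X$, the posets $X\oplus\mathbf{1}$ and $\mathbf{1}\oplus X$ are universally derived equivalent.
   Context: $\mathbf{1}$ denotes the poset with one element. The ordinal sum $P\oplus Q$ of posets $(P,\le_P)$ and $(Q,\le_Q)$ is the poset on $P\sqcup Q$ with $x\le y$ iff ($x,y\in P$ and $x\le_P y$) or ($x,y\in Q$ and $x\le_Q y$) or ($x\in P$ and $y\in Q$). For a poset $P$ (viewed as a small category with a unique morphism $p\to p'$ if $p\le p'$ and none otherwise) and a category $\mathcal{A}$, $\mathcal{A}^P$ denotes the category of functors $P\to\mathcal{A}$. If $\mathcal{A}$ is abelian, so is $\mathcal{A}^P$, and $D(\mathcal{A}^P)$ denotes its (unbounded) derived category with its standard triangulated structure. Two posets $P$ and $Q$ are universally derived equivalent if for every abelian category $\mathcal{A}$ the derived categories $D(\mathcal{A}^P)$ and $D(\mathcal{A}^Q)$ are equivalent as triangulated categories. *)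

(* Defs.v *)
From HB Require Import structures.
From mathcomp Require Import all_boot all_order all_algebra.
From mathcomp Require Import boolp.

Set Implicit Arguments.
Unset Strict Implicit.
Unset Printing Implicit Defensive.

Import Order.TTheory GRing.Theory.
Local Open Scope ring_scope.

Record category := Category {
  cob :> Type;
  hom : cob -> cob -> Type;
  idm : forall x, hom x x;
  comp : forall x y z, hom y z -> hom x y -> hom x z;
  compA : forall x y z t (h : hom z t) (g : hom y z) (f : hom x y),
    comp h (comp g f) = comp (comp h g) f;
  comp1m : forall x y (f : hom x y), comp (idm y) f = f;
  compm1 : forall x y (f : hom x y), comp f (idm x) = f
}.
Arguments idm {c} x.

Declare Scope cat_scope.
Delimit Scope cat_scope with cat.
Local Open Scope cat_scope.
Notation "g \oc f" := (comp g f)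
  (at level 40, left associativity, format "g  \oc  f") : cat_scope.

Definition is_iso (C : category) (x y : C) (f : hom x y) : Prop :=
  exists g : hom y x, g \oc f = idm x /\ f \oc g = idm y.

Record functor (C D : category) := Functor {
  fob :> C -> D;
  fmap : forall x y, hom x y -> hom (fob x) (fob y);
  fmap1 : forall x, fmap (idm x) = idm (fob x);
  fmapM : forall x y z (g : hom y z) (f : hom x y),
    fmap (g \oc f) = fmap g \oc fmap f
}.
Arguments fmap {C D} f {x y} : rename.

Definition id_functor (C : category) : functor C C :=
  @Functor C C (fun x => x) (fun x y f => f)
    (fun x => erefl) (fun x y z g f => erefl).

Lemma comp_fmap1 (C D E : category) (G : functor D E) (F : functor C D) x :
  fmap G (fmap F (idm x)) = idm (G (F x)).
Proof. by rewrite !fmap1. Qed.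

Lemma comp_fmapM (C D E : category) (G : functor D E) (F : functor C D) x y z
    (g : hom y z) (f : hom x y) :
  fmap G (fmap F (g \oc f)) = fmap G (fmap F g) \oc fmap G (fmap F f).
Proof. by rewrite !fmapM. Qed.

Definition comp_functor (C D E : category) (G : functor D E)
    (F : functor C D) : functor C E :=
  @Functor C E (fun x => G (F x)) (fun x y f => fmap G (fmap F f))
    (comp_fmap1 G F) (comp_fmapM G F).

Record nat_trans (C D : category) (F G : functor C D) := NatTrans {
  nt_app :> forall x, hom (F x) (G x);
  nt_nat : forall x y (f : hom x y), nt_app y \oc fmap F f = fmap G f \oc nt_app x
}.

Definition nat_iso (C D : category) (F G : functor C D) : Prop :=
  exists t : nat_trans F G, forall x, is_iso (t x).

Definition is_equivalence (C D : category) (F : functor C D) : Prop :=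
  exists G : functor D C,
    nat_iso (comp_functor G F) (id_functor C) /\
    nat_iso (comp_functor F G) (id_functor D).

Definition poset_category (d : Order.disp_t) (P : porderType d) : category :=
  @Category P (fun x y => (x <= y)%O) (fun x => lexx x)
    (fun x y z yz xy => le_trans xy yz)
    (fun _ _ _ _ _ _ _ => bool_irrelevance _ _)
    (fun _ _ _ => bool_irrelevance _ _)
    (fun _ _ _ => bool_irrelevance _ _).

Record preadditive := Preadditive {
  pob :> Type;
  phom : pob -> pob -> zmodType;
  pid : forall x, phom x x;
  pcomp : forall x y z, phom y z -> phom x y -> phom x z;
  pcompA : forall x y z t (h : phom z t) (g : phom y z) (f : phom x y),
    pcomp h (pcomp g f) = pcomp (pcomp h g) f;
  pcomp1m : forall x y (f : phom x y), pcomp (pid y) f = f;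
  pcompm1 : forall x y (f : phom x y), pcomp f (pid x) = f;
  pcompDl : forall x y z (g g' : phom y z) (f : phom x y),
    pcomp (g + g') f = pcomp g f + pcomp g' f;
  pcompDr : forall x y z (g : phom y z) (f f' : phom x y),
    pcomp g (f + f') = pcomp g f + pcomp g f'
}.
Arguments pid {p} x.

Notation "g \op f" := (pcomp g f)
  (at level 40, left associativity, format "g  \op  f") : cat_scope.

Coercion preadditive_category (A : preadditive) : category :=
  @Category A (fun x y => phom x y) (@pid A) (@pcomp A)
    (@pcompA A) (@pcomp1m A) (@pcompm1 A).

Section PreadditiveTheory.
Variable A : preadditive.
Implicit Types x y z w : A.

Lemma pcomp0m x y z (f : phom x y) : (0 : phom y z) \op f = 0.
Proof. by apply: (addrI (0 \op f)); rewrite -pcompDl !addr0. Qed.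

Lemma pcompm0 x y z (g : phom y z) : g \op (0 : phom x y) = 0.
Proof. by apply: (addrI (g \op 0)); rewrite -pcompDr !addr0. Qed.

Lemma pcompNm x y z (g : phom y z) (f : phom x y) : (- g) \op f = - (g \op f).
Proof. by apply: (addrI (g \op f)); rewrite -pcompDl !subrr pcomp0m. Qed.

Lemma pcompmN x y z (g : phom y z) (f : phom x y) : g \op (- f) = - (g \op f).
Proof. by apply: (addrI (g \op f)); rewrite -pcompDr !subrr pcompm0. Qed.

Lemma pcompBm x y z (g g' : phom y z) (f : phom x y) :
  (g - g') \op f = g \op f - g' \op f.
Proof. by rewrite pcompDl pcompNm. Qed.

Lemma pcompmB x y z (g : phom y z) (f f' : phom x y) :
  g \op (f - f') = g \op f - g \op f'.
Proof. by rewrite pcompDr pcompmN. Qed.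

Definition is_mono x y (m : phom x y) : Prop :=
  forall w (g h : phom w x), m \op g = m \op h -> g = h.

Definition is_epi x y (e : phom x y) : Prop :=
  forall w (g h : phom y w), g \op e = h \op e -> g = h.

Definition is_kernel w x y (f : phom x y) (k : phom w x) : Prop :=
  f \op k = 0 /\
  forall v (g : phom v x), f \op g = 0 -> exists! h : phom v w, k \op h = g.

Definition is_cokernel x y w (f : phom x y) (c : phom y w) : Prop :=
  c \op f = 0 /\
  forall v (g : phom y v), g \op f = 0 -> exists! h : phom w v, h \op c = g.

Lemma is_kernelI w x y (f : phom x y) (k : phom w x) :
    is_mono k -> f \op k = 0 ->
    (forall v (g : phom v x), f \op g = 0 -> exists h, k \op h = g) ->
  is_kernel f k.
Proof.
move=> km k0 kl; split=> // v g /kl [h <-].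
by exists h; split=> // h' /km.
Qed.

Lemma is_cokernelI w x y (f : phom x y) (c : phom y w) :
    is_epi c -> c \op f = 0 ->
    (forall v (g : phom y v), g \op f = 0 -> exists h, h \op c = g) ->
  is_cokernel f c.
Proof.
move=> km k0 kl; split=> // v g /kl [h <-].
by exists h; split=> // h' /km.
Qed.

End PreadditiveTheory.

(* The zero object, biproducts, kernels and cokernels are chosen; any two
   choices are canonically isomorphic. *)
Record abelian_category := AbelianCategory {
  abase :> preadditive;
  zeroob : abase;
  zeroobP : pid zeroob = 0;
  biprod : abase -> abase -> abase;
  inl_ : forall x y, phom x (biprod x y);
  inr_ : forall x y, phom y (biprod x y);
  prl_ : forall x y, phom (biprod x y) x;
  prr_ : forall x y, phom (biprod x y) y;
  prl_inl : forall x y, prl_ x y \op inl_ x y = pid x;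
  prl_inr : forall x y, prl_ x y \op inr_ x y = 0;
  prr_inl : forall x y, prr_ x y \op inl_ x y = 0;
  prr_inr : forall x y, prr_ x y \op inr_ x y = pid y;
  biprod_id : forall x y,
    inl_ x y \op prl_ x y + inr_ x y \op prr_ x y = pid (biprod x y);
  ker : forall x y, phom x y -> abase;
  kerm : forall x y (f : phom x y), phom (ker f) x;
  kerP : forall x y (f : phom x y), is_kernel f (kerm f);
  coker : forall x y, phom x y -> abase;
  cokerm : forall x y (f : phom x y), phom y (coker f);
  cokerP : forall x y (f : phom x y), is_cokernel f (cokerm f);
  mono_normal : forall x y (m : phom x y),
    is_mono m -> exists (z : abase) (f : phom y z), is_kernel f m;
  epi_normal : forall x y (e : phom x y),
    is_epi e -> exists (z : abase) (f : phom z x), is_cokernel f e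
}.
Arguments inl_ {a} x y.
Arguments inr_ {a} x y.
Arguments prl_ {a} x y.
Arguments prr_ {a} x y.
Arguments kerm {a x y} f.
Arguments cokerm {a x y} f.

Section AbelianTheory.
Variable A : abelian_category.
Implicit Types x y z w : A.

Lemma kermK x y (f : phom x y) : f \op kerm f = 0.
Proof. by have [] := kerP f. Qed.

Lemma cokermK x y (f : phom x y) : cokerm f \op f = 0.
Proof. by have [] := cokerP f. Qed.

Lemma kerm_mono x y (f : phom x y) : is_mono (kerm f).
Proof.
move=> w g h gh; have [_ kP] := kerP f.
have e : f \op (kerm f \op g) = 0 by rewrite pcompA kermK pcomp0m.
by have [u [_ uu]] := kP _ _ e; rewrite -(uu g) // -(uu h).
Qed.

Lemma cokerm_epi x y (f : phom x y) : is_epi (cokerm f).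
Proof.
move=> w g h gh; have [_ cP] := cokerP f.
have e : (g \op cokerm f) \op f = 0 by rewrite -pcompA cokermK pcompm0.
by have [u [_ uu]] := cP _ _ e; rewrite -(uu g) // -(uu h).
Qed.

Lemma ker_lift_ex x y (f : phom x y) w (g : phom w x) :
  f \op g = 0 -> exists h : phom w (ker f), kerm f \op h = g.
Proof. by move=> e; have [h [hg _]] := (kerP f).2 _ _ e; exists h. Qed.

Lemma coker_desc_ex x y (f : phom x y) w (g : phom y w) :
  g \op f = 0 -> exists h : phom (coker f) w, h \op cokerm f = g.
Proof. by move=> e; have [h [hg _]] := (cokerP f).2 _ _ e; exists h. Qed.

Definition ker_lift x y (f : phom x y) w (g : phom w x) (e : f \op g = 0) :
  phom w (ker f) := projT1 (cid (ker_lift_ex e)).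

Lemma ker_liftK x y (f : phom x y) w (g : phom w x) (e : f \op g = 0) :
  kerm f \op ker_lift e = g.
Proof. exact: projT2 (cid (ker_lift_ex e)). Qed.

Definition coker_desc x y (f : phom x y) w (g : phom y w) (e : g \op f = 0) :
  phom (coker f) w := projT1 (cid (coker_desc_ex e)).

Lemma coker_descK x y (f : phom x y) w (g : phom y w) (e : g \op f = 0) :
  coker_desc e \op cokerm f = g.
Proof. exact: projT2 (cid (coker_desc_ex e)). Qed.

Lemma mono_kernel_coker x y (m : phom x y) :
  is_mono m -> is_kernel (cokerm m) m.
Proof.
move=> mm; have [z [f [fm fP]]] := mono_normal mm.
apply: is_kernelI => // [|v g e]; first exact: cokermK.
have [|h [hg _]] := fP _ g; last by exists h.
by rewrite -(coker_descK fm) -pcompA e pcompm0.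
Qed.

Lemma epi_cokernel_ker x y (p : phom x y) :
  is_epi p -> is_cokernel (kerm p) p.
Proof.
move=> pp; have [z [f [fp fP]]] := epi_normal pp.
apply: is_cokernelI => // [|v g e]; first exact: kermK.
have [|h [hg _]] := fP _ g; last by exists h.
by rewrite -(ker_liftK fp) pcompA e pcomp0m.
Qed.

Lemma mono_ker0 x y (m : phom x y) : is_mono m <-> kerm m = 0.
Proof.
split=> [mm|k0 w g h gh].
  by apply: mm; rewrite kermK pcompm0.
apply/eqP; rewrite -subr_eq0; apply/eqP.
have e : m \op (g - h) = 0 by rewrite pcompmB gh subrr.
by rewrite -(ker_liftK e) k0 pcomp0m.
Qed.

Lemma epi_coker0 x y (p : phom x y) : is_epi p <-> cokerm p = 0.
Proof.
split=> [mm|k0 w g h gh].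
  by apply: mm; rewrite cokermK pcomp0m.
apply/eqP; rewrite -subr_eq0; apply/eqP.
have e : (g - h) \op p = 0 by rewrite pcompBm gh subrr.
by rewrite -(coker_descK e) k0 pcompm0.
Qed.

Definition biprod_map x y x' y' (f : phom x x') (g : phom y y') :
    phom (biprod x y) (biprod x' y') :=
  inl_ x' y' \op f \op prl_ x y + inr_ x' y' \op g \op prr_ x y.

Lemma biprod_ext_pr w x y (f g : phom w (biprod x y)) :
  prl_ x y \op f = prl_ x y \op g -> prr_ x y \op f = prr_ x y \op g -> f = g.
Proof.
move=> el er; rewrite -[f]pcomp1m -[g]pcomp1m -biprod_id !pcompDl -!pcompA.
by rewrite el er.
Qed.

Lemma biprod_ext_in w x y (f g : phom (biprod x y) w) :
  f \op inl_ x y = g \op inl_ x y -> f \op inr_ x y = g \op inr_ x y -> f = g.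
Proof.
move=> el er; rewrite -[f]pcompm1 -[g]pcompm1 -biprod_id !pcompDr !pcompA.
by rewrite el er.
Qed.

Lemma prl_map x y x' y' (f : phom x x') (g : phom y y') :
  prl_ x' y' \op biprod_map f g = f \op prl_ x y.
Proof.
by rewrite pcompDr !pcompA prl_inl prl_inr pcomp1m !pcomp0m addr0.
Qed.

Lemma prr_map x y x' y' (f : phom x x') (g : phom y y') :
  prr_ x' y' \op biprod_map f g = g \op prr_ x y.
Proof.
by rewrite pcompDr !pcompA prr_inl prr_inr pcomp1m !pcomp0m add0r.
Qed.

Lemma map_inl x y x' y' (f : phom x x') (g : phom y y') :
  biprod_map f g \op inl_ x y = inl_ x' y' \op f.
Proof.
by rewrite pcompDl -!pcompA prl_inl prr_inl pcompm1 !pcompm0 addr0.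
Qed.

Lemma map_inr x y x' y' (f : phom x x') (g : phom y y') :
  biprod_map f g \op inr_ x y = inr_ x' y' \op g.
Proof.
by rewrite pcompDl -!pcompA prl_inr prr_inr pcompm1 !pcompm0 add0r.
Qed.

Lemma biprod_map1 x y : biprod_map (pid x) (pid y) = pid (biprod x y).
Proof. by rewrite /biprod_map !pcompm1 biprod_id. Qed.

Lemma biprod_mapM x y x' y' x'' y'' (f' : phom x' x'') (f : phom x x')
    (g' : phom y' y'') (g : phom y y') :
  biprod_map (f' \op f) (g' \op g) = biprod_map f' g' \op biprod_map f g.
Proof.
apply: biprod_ext_pr.
  by rewrite pcompA !prl_map -!pcompA prl_map.
by rewrite pcompA !prr_map -!pcompA prr_map.
Qed.

End AbelianTheory.

(* The abelian category A^P of functors from a poset P to A. Its morphisms are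
   the natural transformations, stated with homs of A in zmodType rather than
   through nat_trans so as not to force the objects of A to form a small type. *)

Section Diagrams.
Variables (d : Order.disp_t) (P : porderType d) (A : preadditive).
Implicit Types F G : functor (poset_category P) A.

Record diagram_map F G := DiagramMap {
  dm :> forall p : P, phom (F p) (G p);
  dm_nat : forall (p q : P) (f : hom (p : poset_category P) q),
    dm q \op fmap F f = fmap G f \op dm p
}.

Lemma diagram_map_ext F G (s t : diagram_map F G) :
  (forall x, s x = t x) -> s = t.
Proof.
case: s t => [s sn] [t tn] /= st.
have {}st : s = t by apply: functional_extensionality_dep.
by rewrite {s}st in sn *; congr DiagramMap; apply: Prop_irrelevance.
Qed.

HB.instance Definition _ F G := gen_eqMixin (diagram_map F G).
HB.instance Definition _ F G := gen_choiceMixin (diagram_map F G).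

End Diagrams.

Section FunctorPreadditive.
Variables (d : Order.disp_t) (P : porderType d) (A : preadditive).
Implicit Types F G H : functor (poset_category P) A.

Definition dm_zero F G : diagram_map F G.
Proof.
exists (fun x => (0 : phom (F x) (G x))) => x y f /=.
by rewrite pcomp0m pcompm0.
Defined.

Definition dm_opp F G (s : diagram_map F G) : diagram_map F G.
Proof.
exists (fun x => - s x) => x y f /=.
by rewrite pcompNm pcompmN; congr (- _); exact: (dm_nat s f).
Defined.

Definition dm_add F G (s t : diagram_map F G) : diagram_map F G.
Proof.
exists (fun x => s x + t x) => x y f /=.
by rewrite pcompDl pcompDr; congr (_ + _); [exact: (dm_nat s f)|exact: (dm_nat t f)].
Defined.

Lemma dm_addA F G : associative (@dm_add F G).
Proof. by move=> s t u; apply: diagram_map_ext => x /=; rewrite addrA. Qed.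
Lemma dm_addC F G : commutative (@dm_add F G).
Proof. by move=> s t; apply: diagram_map_ext => x /=; rewrite addrC. Qed.
Lemma dm_add0 F G : left_id (dm_zero F G) (@dm_add F G).
Proof. by move=> s; apply: diagram_map_ext => x /=; rewrite add0r. Qed.
Lemma dm_addN F G : left_inverse (dm_zero F G) (@dm_opp F G) (@dm_add F G).
Proof. by move=> s; apply: diagram_map_ext => x /=; rewrite addNr. Qed.

HB.instance Definition _ F G := GRing.isZmodule.Build (diagram_map F G)
  (@dm_addA F G) (@dm_addC F G) (@dm_add0 F G) (@dm_addN F G).

Definition dm_id F : diagram_map F F.
Proof.
by exists (fun x => pid (F x)) => x y f /=; rewrite pcomp1m pcompm1.
Defined.

Definition dm_comp F G H (t : diagram_map G H) (s : diagram_map F G) : diagram_map F H.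
Proof.
exists (fun x => t x \op s x) => x y f /=.
have /= es := dm_nat s f; have /= et := dm_nat t f.
by rewrite -pcompA es pcompA et pcompA.
Defined.

Lemma dm_compA F G H K (u : diagram_map H K) (t : diagram_map G H)
  (s : diagram_map F G) : dm_comp u (dm_comp t s) = dm_comp (dm_comp u t) s.
Proof. by apply: diagram_map_ext => x /=; rewrite pcompA. Qed.
Lemma dm_comp1m F G (s : diagram_map F G) : dm_comp (dm_id G) s = s.
Proof. by apply: diagram_map_ext => x /=; rewrite pcomp1m. Qed.
Lemma dm_compm1 F G (s : diagram_map F G) : dm_comp s (dm_id F) = s.
Proof. by apply: diagram_map_ext => x /=; rewrite pcompm1. Qed.
Lemma dm_compDl F G H (t t' : diagram_map G H) (s : diagram_map F G) :
  dm_comp (t + t') s = dm_comp t s + dm_comp t' s.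
Proof. by apply: diagram_map_ext => x /=; rewrite pcompDl. Qed.
Lemma dm_compDr F G H (t : diagram_map G H) (s s' : diagram_map F G) :
  dm_comp t (s + s') = dm_comp t s + dm_comp t s'.
Proof. by apply: diagram_map_ext => x /=; rewrite pcompDr. Qed.

Definition functor_preadditive : preadditive :=
  @Preadditive (functor (poset_category P) A) (fun F G => diagram_map F G)
    dm_id dm_comp dm_compA dm_comp1m dm_compm1 dm_compDl dm_compDr.

End FunctorPreadditive.

Section FunctorAbelian.
Variables (d : Order.disp_t) (P : porderType d) (A : abelian_category).
Notation AP := (functor_preadditive P A).
Implicit Types F G H : AP.

Definition fzero : AP.
Proof.
exists (fun _ => zeroob A : A) (fun _ _ _ => pid (zeroob A)) => //= *.
by rewrite pcomp1m.
Defined.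

Lemma fzeroP : pid fzero = 0.
Proof. by apply: diagram_map_ext => x /=; rewrite zeroobP. Qed.

Definition fbiprod F G : AP.
Proof.
exists (fun x => biprod (F x : A) (G x : A))
       (fun x y f => biprod_map (fmap F f) (fmap G f)) => [x|x y z g f] /=.
  by rewrite !fmap1 /= biprod_map1.
by rewrite !fmapM /= biprod_mapM.
Defined.

Definition finl F G : phom F (fbiprod F G).
Proof.
exists (fun x => inl_ (F x : A) (G x : A)) => x y f /=.
by rewrite map_inl.
Defined.

Definition finr F G : phom G (fbiprod F G).
Proof.
exists (fun x => inr_ (F x : A) (G x : A)) => x y f /=.
by rewrite map_inr.
Defined.

Definition fprl F G : phom (fbiprod F G) F.
Proof.
exists (fun x => prl_ (F x : A) (G x : A)) => x y f /=.
by rewrite prl_map.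
Defined.

Definition fprr F G : phom (fbiprod F G) G.
Proof.
exists (fun x => prr_ (F x : A) (G x : A)) => x y f /=.
by rewrite prr_map.
Defined.

Lemma fprl_inl F G : fprl F G \op finl F G = pid F.
Proof. by apply: diagram_map_ext => x /=; rewrite prl_inl. Qed.
Lemma fprl_inr F G : fprl F G \op finr F G = 0.
Proof. by apply: diagram_map_ext => x /=; rewrite prl_inr. Qed.
Lemma fprr_inl F G : fprr F G \op finl F G = 0.
Proof. by apply: diagram_map_ext => x /=; rewrite prr_inl. Qed.
Lemma fprr_inr F G : fprr F G \op finr F G = pid G.
Proof. by apply: diagram_map_ext => x /=; rewrite prr_inr. Qed.
Lemma fbiprod_id F G :
  finl F G \op fprl F G + finr F G \op fprr F G = pid (fbiprod F G).
Proof. by apply: diagram_map_ext => x /=; rewrite biprod_id. Qed.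

Section Kernel.
Variables (F G : AP) (s : phom F G).
Let sa x : phom (F x : A) (G x) := s x.

Lemma fker_subproof x y (f : hom x y) :
  sa y \op ((fmap F f : phom (F x : A) (F y)) \op kerm (sa x)) = 0.
Proof.
have /= e := dm_nat s f.
by rewrite pcompA e -pcompA kermK pcompm0.
Qed.

Lemma fcoker_subproof x y (f : hom x y) :
  (cokerm (sa y) \op (fmap G f : phom (G x : A) (G y))) \op sa x = 0.
Proof.
have /= e := dm_nat s f.
by rewrite -pcompA -[X in _ \op X]e pcompA cokermK pcomp0m.
Qed.

Definition fker : AP.
Proof.
exists (fun x => ker (sa x)) (fun x y f => ker_lift (fker_subproof f)).
  move=> x; apply: (kerm_mono (f := sa x)).
  by rewrite ker_liftK fmap1 /= pcomp1m pcompm1.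
move=> x y z g f; apply: (kerm_mono (f := sa z)) => /=.
by rewrite pcompA !ker_liftK -pcompA ker_liftK fmapM /= pcompA.
Defined.

Definition fcoker : AP.
Proof.
exists (fun x => coker (sa x)) (fun x y f => coker_desc (fcoker_subproof f)).
  move=> x; apply: (cokerm_epi (f := sa x)).
  by rewrite coker_descK fmap1 /= pcomp1m pcompm1.
move=> x y z g f; apply: (cokerm_epi (f := sa x)) => /=.
by rewrite -pcompA !coker_descK pcompA coker_descK fmapM /= pcompA.
Defined.

Definition fkerm : phom fker F.
Proof.
exists (fun x => kerm (sa x)) => x y f /=.
by rewrite ker_liftK.
Defined.

Definition fcokerm : phom G fcoker.
Proof.
exists (fun x => cokerm (sa x)) => x y f /=.
by rewrite coker_descK.
Defined.

Lemma is_kernel_pointwise (K : AP) (k : phom K F) :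
  (forall x, is_kernel (sa x) (k x : phom (K x : A) (F x))) -> is_kernel s k.
Proof.
move=> kP.
have km x : is_mono (k x : phom (K x : A) (F x)).
  move=> w g h gh; have [k0 kl] := kP x.
  have e : sa x \op ((k x : phom (K x : A) (F x)) \op g) = 0.
    by rewrite pcompA k0 pcomp0m.
  by have [u [_ uu]] := kl _ _ e; rewrite -(uu g) // -(uu h).
apply: is_kernelI.
- move=> H g h gh; apply: diagram_map_ext => x; apply: km.
  by have /= -> := congr1 (fun t : diagram_map H F => t x) gh.
- by apply: diagram_map_ext => x /=; have [] := kP x.
move=> H g sg0.
have ex x : exists h : phom (H x : A) (K x), (k x : phom (K x : A) (F x)) \op h = g x.
  have e : sa x \op (g x : phom (H x : A) (F x)) = 0.
    exact: (congr1 (fun t : diagram_map H G => t x) sg0).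
  by have [h [hg _]] := (kP x).2 _ _ e; exists h.
pose h x := projT1 (cid (ex x)); have hP x := projT2 (cid (ex x)).
unshelve eexists.
  exists h => x y f; apply: (km y) => /=.
  have /= ek := dm_nat k f; have /= eg := dm_nat g f.
  by rewrite !pcompA hP eg ek -pcompA hP.
by apply: diagram_map_ext => x /=.
Qed.

Lemma is_cokernel_pointwise (K : AP) (k : phom G K) :
  (forall x, is_cokernel (sa x) (k x : phom (G x : A) (K x))) -> is_cokernel s k.
Proof.
move=> kP.
have km x : is_epi (k x : phom (G x : A) (K x)).
  move=> w g h gh; have [k0 kl] := kP x.
  have e : (g \op (k x : phom (G x : A) (K x))) \op sa x = 0.
    by rewrite -pcompA k0 pcompm0.
  by have [u [_ uu]] := kl _ _ e; rewrite -(uu g) // -(uu h).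
apply: is_cokernelI.
- move=> H g h gh; apply: diagram_map_ext => x; apply: km.
  by have /= -> := congr1 (fun t : diagram_map G H => t x) gh.
- by apply: diagram_map_ext => x /=; have [] := kP x.
move=> H g sg0.
have ex x : exists h : phom (K x : A) (H x), h \op (k x : phom (G x : A) (K x)) = g x.
  have e : (g x : phom (G x : A) (H x)) \op sa x = 0.
    exact: (congr1 (fun t : diagram_map F H => t x) sg0).
  by have [h [hg _]] := (kP x).2 _ _ e; exists h.
pose h x := projT1 (cid (ex x)); have hP x := projT2 (cid (ex x)).
unshelve eexists.
  exists h => x y f; apply: (km x) => /=.
  have /= ek := dm_nat k f; have /= eg := dm_nat g f.
  by rewrite -!pcompA hP -eg -ek pcompA hP.
by apply: diagram_map_ext => x /=.
Qed.

Lemma fkerP : is_kernel s fkerm.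
Proof. by apply: is_kernel_pointwise => x; apply: kerP. Qed.

Lemma fcokerP : is_cokernel s fcokerm.
Proof. by apply: is_cokernel_pointwise => x; apply: cokerP. Qed.

End Kernel.

Lemma fmono_normal F G (m : phom F G) :
  is_mono m -> exists (H : AP) (f : phom G H), is_kernel f m.
Proof.
move=> mm; exists (fcoker m), (fcokerm m).
apply: is_kernel_pointwise => x; apply: mono_kernel_coker.
apply/mono_ker0.
have k0 : fkerm m = 0 by apply: mm; rewrite (fkerP m).1 pcompm0.
exact: (congr1 (fun t : diagram_map (fker m) F => t x) k0).
Qed.

Lemma fepi_normal F G (p : phom F G) :
  is_epi p -> exists (H : AP) (f : phom H F), is_cokernel f p.
Proof.
move=> pp; exists (fker p), (fkerm p).
apply: is_cokernel_pointwise => x; apply: epi_cokernel_ker.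
apply/epi_coker0.
have k0 : fcokerm p = 0 by apply: pp; rewrite (fcokerP p).1 pcomp0m.
exact: (congr1 (fun t : diagram_map G (fcoker p) => t x) k0).
Qed.

Definition functor_category : abelian_category :=
  @AbelianCategory AP fzero fzeroP fbiprod finl finr fprl fprr
    fprl_inl fprl_inr fprr_inl fprr_inr fbiprod_id
    fker fkerm fkerP fcoker fcokerm fcokerP fmono_normal fepi_normal.

End FunctorAbelian.

Section Homology.
Variable A : abelian_category.

Definition homology (x y z : A) (f : phom x y) (g : phom y z)
    (gf0 : g \op f = 0) : A :=
  coker (ker_lift gf0).

Section Map.
Variables (x y z x' y' z' : A).
Variables (f : phom x y) (g : phom y z) (gf0 : g \op f = 0).
Variables (f' : phom x' y') (g' : phom y' z') (gf0' : g' \op f' = 0).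
Variables (a : phom x x') (b : phom y y') (c : phom z z').
Hypotheses (ba : b \op f = f' \op a) (cb : c \op g = g' \op b).

Lemma cycles_map_subproof : g' \op (b \op kerm g) = 0.
Proof. by rewrite pcompA -cb -pcompA kermK pcompm0. Qed.

Definition cycles_map : phom (ker g) (ker g') := ker_lift cycles_map_subproof.

Lemma cycles_mapK : kerm g' \op cycles_map = b \op kerm g.
Proof. exact: ker_liftK. Qed.

Lemma homology_map_subproof :
  (cokerm (ker_lift gf0') \op cycles_map) \op ker_lift gf0 = 0.
Proof.
have e : cycles_map \op ker_lift gf0 = ker_lift gf0' \op a.
  apply: kerm_mono; rewrite pcompA cycles_mapK -pcompA ker_liftK ba.
  by rewrite pcompA ker_liftK.
by rewrite -pcompA e pcompA cokermK pcomp0m.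
Qed.

Definition homology_map : phom (homology gf0) (homology gf0') :=
  coker_desc homology_map_subproof.

Lemma homology_mapK : homology_map \op cokerm (ker_lift gf0) =
  cokerm (ker_lift gf0') \op cycles_map.
Proof. exact: coker_descK. Qed.

End Map.

Lemma homology_map1 (x y z : A) (f : phom x y) (g : phom y z)
    (gf0 : g \op f = 0) a c (ba : pid y \op f = f \op a)
    (cb : c \op g = g \op pid y) :
  homology_map gf0 gf0 ba cb = pid (homology gf0).
Proof.
apply: cokerm_epi; rewrite homology_mapK pcomp1m -[RHS]pcompm1; congr (_ \op _).
by apply: kerm_mono; rewrite cycles_mapK pcomp1m pcompm1.
Qed.

Lemma homology_mapM (x y z x' y' z' x'' y'' z'' : A)
    (f : phom x y) (g : phom y z) (gf0 : g \op f = 0)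
    (f' : phom x' y') (g' : phom y' z') (gf0' : g' \op f' = 0)
    (f'' : phom x'' y'') (g'' : phom y'' z'') (gf0'' : g'' \op f'' = 0)
    a b c (ba : b \op f = f' \op a) (cb : c \op g = g' \op b)
    a' b' c' (ba' : b' \op f' = f'' \op a') (cb' : c' \op g' = g'' \op b')
    a'' b'' c'' (ba'' : b'' \op f = f'' \op a'')
    (cb'' : c'' \op g = g'' \op b'') :
  b'' = b' \op b ->
  homology_map gf0 gf0'' ba'' cb'' =
    homology_map gf0' gf0'' ba' cb' \op homology_map gf0 gf0' ba cb.
Proof.
move=> eb; apply: cokerm_epi.
rewrite -pcompA !homology_mapK pcompA homology_mapK -pcompA; congr (_ \op _).
apply: kerm_mono; rewrite pcompA !cycles_mapK -pcompA cycles_mapK.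
by rewrite pcompA eb.
Qed.

End Homology.

Definition succz (n : int) : int := n + 1.

Record complex (A : preadditive) := Complex {
  cx :> int -> A;
  cx_d : forall n, phom (cx n) (cx (succz n));
  cx_dd : forall n, cx_d (succz n) \op cx_d n = 0
}.

Record chain_map (A : preadditive) (X Y : complex A) := ChainMap {
  cm :> forall n, phom (X n) (Y n);
  cm_d : forall n, cm (succz n) \op cx_d X n = cx_d Y n \op cm n
}.

Lemma chain_map_ext (A : preadditive) (X Y : complex A) (f g : chain_map X Y) :
  (forall n, f n = g n) -> f = g.
Proof.
case: f g => [f fd] [g gd] /= fg.
have {}fg : f = g by apply: functional_extensionality_dep.
by rewrite {f}fg in fd *; congr ChainMap; apply: Prop_irrelevance.
Qed.

Section Complexes.
Variable A : abelian_category.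
Implicit Types X Y Z : complex A.

Definition chain_id X : chain_map X X.
Proof. by exists (fun n => pid (X n)) => n; rewrite pcomp1m pcompm1. Defined.

Definition chain_comp X Y Z (g : chain_map Y Z) (f : chain_map X Y) :
  chain_map X Z.
Proof.
exists (fun n => g n \op f n) => n.
by rewrite /= -pcompA cm_d pcompA cm_d pcompA.
Defined.

Lemma chain_compA X Y Z T (h : chain_map Z T) (g : chain_map Y Z)
  (f : chain_map X Y) : chain_comp h (chain_comp g f) = chain_comp (chain_comp h g) f.
Proof. by apply: chain_map_ext => n /=; rewrite pcompA. Qed.
Lemma chain_comp1m X Y (f : chain_map X Y) : chain_comp (chain_id Y) f = f.
Proof. by apply: chain_map_ext => n /=; rewrite pcomp1m. Qed.
Lemma chain_compm1 X Y (f : chain_map X Y) : chain_comp f (chain_id X) = f.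
Proof. by apply: chain_map_ext => n /=; rewrite pcompm1. Qed.

Definition complex_category : category :=
  @Category (complex A) (@chain_map A) chain_id chain_comp
    chain_compA chain_comp1m chain_compm1.

(* H^{n+1}: indexing by n + 1 avoids transporting along n - 1 + 1 = n, and
   covers every degree as n ranges over int. *)
Definition cohomology_map X Y (f : chain_map X Y) (n : int) :
    phom (homology (cx_dd X n)) (homology (cx_dd Y n)) :=
  homology_map (cx_dd X n) (cx_dd Y n) (cm_d f n) (cm_d f (succz n)).

Definition quasi_iso X Y (f : chain_map X Y) : Prop :=
  forall n, @is_iso A _ _ (cohomology_map f n).

Definition shift_complex X : complex A.
Proof.
exists (fun n => X (succz n)) (fun n => - cx_d X (succz n)) => n.
by rewrite pcompNm pcompmN opprK cx_dd.
Defined.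

Definition shift_map X Y (f : chain_map X Y) :
  chain_map (shift_complex X) (shift_complex Y).
Proof.
exists (fun n => f (succz n)) => n /=.
by rewrite pcompNm pcompmN; congr (- _); apply: cm_d.
Defined.

Lemma shift_map1 X : shift_map (chain_id X) = chain_id (shift_complex X).
Proof. exact: chain_map_ext. Qed.

Lemma shift_mapM X Y Z (g : chain_map Y Z) (f : chain_map X Y) :
  shift_map (chain_comp g f) = chain_comp (shift_map g) (shift_map f).
Proof. exact: chain_map_ext. Qed.

Definition shift_functor : functor complex_category complex_category :=
  @Functor complex_category complex_category
    shift_complex shift_map shift_map1 shift_mapM.

(* The differential of the shift carries a sign, so the homology of X[1] is
   only isomorphic to that of X, through (-1, 1, -1). *)
Lemma sign_in X n :
  pid (X (succz n)) \op cx_d X n = - cx_d X n \op - pid (X n).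
Proof. by rewrite pcompNm pcompmN opprK pcomp1m pcompm1. Qed.

Lemma sign_out X n :
  - pid (X (succz n)) \op cx_d X n = - cx_d X n \op pid (X n).
Proof. by rewrite !pcompNm pcomp1m pcompm1. Qed.

Lemma sign_in' X n :
  pid (X (succz n)) \op - cx_d X n = cx_d X n \op - pid (X n).
Proof. by rewrite !pcompmN pcomp1m pcompm1. Qed.

Lemma sign_out' X n :
  - pid (X (succz n)) \op - cx_d X n = cx_d X n \op pid (X n).
Proof. by rewrite pcompNm pcompmN opprK pcomp1m pcompm1. Qed.

Lemma shift_quasi_iso X Y (f : chain_map X Y) :
  quasi_iso f -> quasi_iso (shift_map f).
Proof.
move=> fq n; have [/= g [gf fg]] := fq (succz n).
pose to_shift Z := homology_map (cx_dd Z (succz n)) (cx_dd (shift_complex Z) n)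
  (sign_in Z (succz n)) (sign_out Z (succz (succz n))).
pose of_shift Z := homology_map (cx_dd (shift_complex Z) n) (cx_dd Z (succz n))
  (sign_in' Z (succz n)) (sign_out' Z (succz (succz n))).
have E : cohomology_map (shift_map f) n \op to_shift X
    = to_shift Y \op cohomology_map f (succz n).
  have ba : f (succz (succz n)) \op cx_d X (succz n) =
      - cx_d Y (succz n) \op - f (succz n).
    by rewrite pcompNm pcompmN opprK cm_d.
  have cb : - f (succz (succz (succz n))) \op cx_d X (succz (succz n)) =
      - cx_d Y (succz (succz n)) \op f (succz (succz n)).
    by rewrite !pcompNm cm_d.
  transitivity (homology_map (cx_dd X (succz n)) (cx_dd (shift_complex Y) n) ba cb).
    by apply/esym/homology_mapM; rewrite /= pcompm1.
  by apply: homology_mapM; rewrite /= pcomp1m.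
have toK Z : to_shift Z \op of_shift Z = pid _.
  have e1 : pid (Z (succz (succz n))) \op - cx_d Z (succz n) =
    - cx_d Z (succz n) \op pid _ by rewrite pcomp1m pcompm1.
  have e2 : pid _ \op - cx_d Z (succz (succz n)) =
    - cx_d Z (succz (succz n)) \op pid _ by rewrite pcomp1m pcompm1.
  rewrite -(homology_map1 (cx_dd (shift_complex Z) n) e1 e2).
  by apply/esym/homology_mapM; rewrite pcomp1m.
have ofK Z : of_shift Z \op to_shift Z = pid _.
  have e1 : pid (Z (succz (succz n))) \op cx_d Z (succz n) =
    cx_d Z (succz n) \op pid _ by rewrite pcomp1m pcompm1.
  have e2 : pid _ \op cx_d Z (succz (succz n)) =
    cx_d Z (succz (succz n)) \op pid _ by rewrite pcomp1m pcompm1.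
  rewrite -(homology_map1 (cx_dd Z (succz n)) e1 e2).
  by apply/esym/homology_mapM; rewrite pcomp1m.
exists (to_shift X \op g \op of_shift Y) => /=; split.
  have -> : cohomology_map (shift_map f) n =
      to_shift Y \op cohomology_map f (succz n) \op of_shift X.
    by rewrite -E -pcompA toK pcompm1.
  rewrite !pcompA -[_ \op of_shift Y \op _]pcompA ofK pcompm1.
  by rewrite -[_ \op g \op _]pcompA gf pcompm1 toK.
by rewrite !pcompA E -[_ \op _ \op g]pcompA fg pcompm1 toK.
Qed.

Definition direct_sum X Y : complex A.
Proof.
exists (fun n => biprod (X n) (Y n))
       (fun n => biprod_map (cx_d X n) (cx_d Y n)) => n.
by rewrite -biprod_mapM !cx_dd /biprod_map !pcompm0 !pcomp0m addr0.
Defined.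

Definition direct_sum_inl X Y : chain_map X (direct_sum X Y).
Proof. by exists (fun n => inl_ (X n) (Y n)) => n /=; rewrite map_inl. Defined.

Definition direct_sum_inr X Y : chain_map Y (direct_sum X Y).
Proof. by exists (fun n => inr_ (X n) (Y n)) => n /=; rewrite map_inr. Defined.

Definition diagonal X : chain_map X (direct_sum X X).
Proof.
exists (fun n => inl_ (X n) (X n) + inr_ (X n) (X n)) => n /=.
by rewrite pcompDl pcompDr map_inl map_inr.
Defined.

(* Cone(f)^n = X^{n+1} (+) Y^n with differential (x, y) |-> (-dx, f x + dy) *)
Definition cone_d X Y (f : chain_map X Y) (n : int) :
    phom (biprod (X (succz n)) (Y n)) (biprod (X (succz (succz n))) (Y (succz n))) :=
  inl_ _ _ \op (- cx_d X (succz n) \op prl_ _ _)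
  + inr_ _ _ \op (f (succz n) \op prl_ _ _ + cx_d Y n \op prr_ _ _).

Lemma cone_dd X Y (f : chain_map X Y) n : cone_d f (succz n) \op cone_d f n = 0.
Proof.
have el m : prl_ _ _ \op cone_d f m = - cx_d X (succz m) \op prl_ _ _.
  by rewrite /cone_d pcompDr !pcompA prl_inl prl_inr pcomp1m !pcomp0m addr0.
have er m : prr_ _ _ \op cone_d f m =
    f (succz m) \op prl_ _ _ + cx_d Y m \op prr_ _ _.
  rewrite /cone_d pcompDr pcompA prr_inl pcomp0m add0r.
  by rewrite [LHS]pcompA prr_inr pcomp1m.
apply: biprod_ext_pr; rewrite pcompm0 pcompA ?el ?er.
  by rewrite -pcompA el pcompA pcompNm pcompmN opprK cx_dd pcomp0m.
rewrite pcompDl -!pcompA el er pcompDr !pcompA cx_dd pcomp0m addr0.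
by rewrite pcompmN cm_d pcompNm addNr.
Qed.

Definition cone X Y (f : chain_map X Y) : complex A := Complex (cone_dd f).

Definition cone_in X Y (f : chain_map X Y) : chain_map Y (cone f).
Proof.
exists (fun n => inr_ (X (succz n)) (Y n)) => n.
rewrite /= /cone_d pcompDl -!pcompA prl_inr !pcompm0 add0r.
by rewrite pcompDl -!pcompA prl_inr prr_inr pcompm0 pcompm1 add0r.
Defined.

Definition cone_out X Y (f : chain_map X Y) : chain_map (cone f) (shift_complex X).
Proof.
exists (fun n => prl_ (X (succz n)) (Y n)) => n.
by rewrite /= /cone_d pcompDr !pcompA prl_inl prl_inr pcomp1m !pcomp0m addr0.
Defined.

End Complexes.

(* Localization of a category C at a class W of morphisms: morphisms are formal
   composites of morphisms of C and formal inverses of morphisms of W, modulo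
   the least congruence for which C -> C[W^-1] is a functor and each formal
   inverse is a two-sided inverse. *)

Section Localization.
Variables (C : category) (W : forall x y : C, hom x y -> Prop).

Inductive lterm : C -> C -> Type :=
| lmor x y (f : hom x y) : lterm x y
| linv x y (s : hom x y) (Ws : W s) : lterm y x
| lcomp x y z (u : lterm y z) (t : lterm x y) : lterm x z.

Inductive lrel : forall x y, lterm x y -> lterm x y -> Prop :=
| lrel_refl x y (t : lterm x y) : lrel t t
| lrel_sym x y (t u : lterm x y) : lrel t u -> lrel u t
| lrel_trans x y (t u v : lterm x y) : lrel t u -> lrel u v -> lrel t v
| lrel_comp x y z (u u' : lterm y z) (t t' : lterm x y) :
    lrel u u' -> lrel t t' -> lrel (lcomp u t) (lcomp u' t')
| lrel_compA x y z w (v : lterm z w) (u : lterm y z) (t : lterm x y) :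
    lrel (lcomp v (lcomp u t)) (lcomp (lcomp v u) t)
| lrel_comp1m x y (t : lterm x y) : lrel (lcomp (lmor (idm y)) t) t
| lrel_compm1 x y (t : lterm x y) : lrel (lcomp t (lmor (idm x))) t
| lrel_mor x y z (g : hom y z) (f : hom x y) :
    lrel (lmor (g \oc f)) (lcomp (lmor g) (lmor f))
| lrel_invl x y (s : hom x y) (Ws : W s) :
    lrel (lcomp (linv Ws) (lmor s)) (lmor (idm x))
| lrel_invr x y (s : hom x y) (Ws : W s) :
    lrel (lcomp (lmor s) (linv Ws)) (lmor (idm y)).

(* Equivalence classes as predicates: {eq_quot _} would bound the universe of
   the objects of C by that of the carriers of choiceType. *)
Record lhom (x y : C) := LHom {
  lpred : lterm x y -> Prop;
  lpred_class : exists t, lpred = lrel t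
}.

Definition lclass x y (t : lterm x y) : lhom x y :=
  LHom (ex_intro _ t (erefl (lrel t))).

Definition lrepr x y (a : lhom x y) : lterm x y :=
  projT1 (cid (lpred_class a)).

Lemma lhom_ext x y (a b : lhom x y) : lpred a = lpred b -> a = b.
Proof.
case: a b => [p pP] [q qP] /= pq; rewrite {p}pq in pP *.
by congr LHom; apply: Prop_irrelevance.
Qed.

Lemma lclass_eq x y (t u : lterm x y) : lclass t = lclass u <-> lrel t u.
Proof.
split=> [/(congr1 (@lpred x y)) /= tu|tu].
  by rewrite tu; apply: lrel_refl.
apply: lhom_ext => /=; apply/funext => v; apply/propext.
by split; apply: lrel_trans => //; apply: lrel_sym.
Qed.

Lemma lclass_repr x y (a : lhom x y) : lclass (lrepr a) = a.
Proof. by apply: lhom_ext; exact: (esym (projT2 (cid (lpred_class a)))). Qed.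

Lemma lrel_repr x y (t : lterm x y) : lrel (lrepr (lclass t)) t.
Proof. by apply/lclass_eq; rewrite lclass_repr. Qed.

Definition lhom_comp x y z (b : lhom y z) (a : lhom x y) : lhom x z :=
  lclass (lcomp (lrepr b) (lrepr a)).

Lemma lhom_compE x y z (u : lterm y z) (t : lterm x y) :
  lhom_comp (lclass u) (lclass t) = lclass (lcomp u t).
Proof. by apply/lclass_eq/lrel_comp; apply: lrel_repr. Qed.

Lemma lhom_compA x y z w (c : lhom z w) (b : lhom y z) (a : lhom x y) :
  lhom_comp c (lhom_comp b a) = lhom_comp (lhom_comp c b) a.
Proof.
rewrite -[a]lclass_repr -[b]lclass_repr -[c]lclass_repr !lhom_compE.
by apply/lclass_eq/lrel_compA.
Qed.

Lemma lhom_comp1m x y (a : lhom x y) : lhom_comp (lclass (lmor (idm y))) a = a.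
Proof.
by rewrite -[a]lclass_repr lhom_compE; apply/lclass_eq/lrel_comp1m.
Qed.

Lemma lhom_compm1 x y (a : lhom x y) : lhom_comp a (lclass (lmor (idm x))) = a.
Proof.
by rewrite -[a]lclass_repr lhom_compE; apply/lclass_eq/lrel_compm1.
Qed.

Definition localization : category :=
  @Category C lhom (fun x => lclass (lmor (idm x))) lhom_comp
    lhom_compA lhom_comp1m lhom_compm1.

Lemma loc_functorM x y z (g : hom y z) (f : hom x y) :
  lclass (lmor (g \oc f)) = lhom_comp (lclass (lmor g)) (lclass (lmor f)).
Proof. by rewrite lhom_compE; apply/lclass_eq/lrel_mor. Qed.

Definition loc_functor : functor C localization :=
  @Functor C localization (fun x => x) (fun x y f => lclass (lmor f))
    (fun x => erefl) loc_functorM.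

End Localization.

Section LocalizedFunctor.
Variables (C D : category).
Variables (W : forall x y : C, hom x y -> Prop).
Variables (W' : forall x y : D, hom x y -> Prop).
Variables (F : functor C D).
Hypothesis FW : forall x y (s : hom x y), W s -> W' (fmap F s).

Fixpoint lterm_map x y (t : lterm W x y) : lterm W' (F x) (F y) :=
  match t with
  | lmor _ _ f => lmor W' (fmap F f)
  | linv _ _ s Ws => linv (FW Ws)
  | lcomp _ _ _ u t => lcomp (lterm_map u) (lterm_map t)
  end.

Lemma lterm_map_rel x y (t u : lterm W x y) :
  lrel t u -> lrel (lterm_map t) (lterm_map u).
Proof.
elim=> /=; try by econstructor; eauto.
- by move=> *; rewrite fmap1; constructor.
- by move=> *; rewrite fmap1; constructor.
- by move=> *; rewrite fmapM; constructor.
- by move=> *; rewrite fmap1; constructor.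
- by move=> *; rewrite fmap1; constructor.
Qed.

Definition lhom_map x y (a : lhom W x y) : lhom W' (F x) (F y) :=
  lclass (lterm_map (lrepr a)).

Lemma lhom_mapE x y (t : lterm W x y) :
  lhom_map (lclass t) = lclass (lterm_map t).
Proof. by apply/lclass_eq/lterm_map_rel/lrel_repr. Qed.

Lemma lhom_map1 x :
  lhom_map (lclass (lmor W (idm x))) = lclass (lmor W' (idm (F x))).
Proof. by rewrite lhom_mapE /= fmap1. Qed.

Lemma lhom_mapM x y z (b : lhom W y z) (a : lhom W x y) :
  lhom_map (lhom_comp b a) = lhom_comp (lhom_map b) (lhom_map a).
Proof.
by rewrite -[a]lclass_repr -[b]lclass_repr lhom_compE !lhom_mapE lhom_compE.
Qed.

Definition localized_functor : functor (localization W) (localization W') :=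
  @Functor (localization W) (localization W') (fun x => F x)
    lhom_map lhom_map1 lhom_mapM.

End LocalizedFunctor.

(* The data of a triangulated category on which the notion of triangulated
   functor depends; the addition of parallel morphisms is given by its graph. *)
Record triangulated_data := TriangulatedData {
  tcat :> category;
  is_sum : forall x y : tcat, hom x y -> hom x y -> hom x y -> Prop;
  tshift : functor tcat tcat;
  distinguished : forall x y z : tcat,
    hom x y -> hom y z -> hom z (tshift x) -> Prop
}.
Arguments is_sum {t x y}.
Arguments distinguished {t x y z}.

Section DerivedCategory.
Variable A : abelian_category.

Definition derived_category : category :=
  @localization (complex_category A) (@quasi_iso A).

Definition derived_loc : functor (complex_category A) derived_category :=
  @loc_functor (complex_category A) (@quasi_iso A).
Notation Q := derived_loc.

Definition derived_shift : functor derived_category derived_category :=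
  @localized_functor (complex_category A) (complex_category A)
    (@quasi_iso A) (@quasi_iso A) (shift_functor A) (@shift_quasi_iso A).

(* X (+) X is also the direct sum in the derived category, so that the sum of
   f and g is (f, g) o diagonal. *)
Definition derived_is_sum (X Y : derived_category) (f g h : hom X Y) : Prop :=
  exists u : hom (direct_sum X X : derived_category) Y,
    [/\ u \oc fmap Q (direct_sum_inl X X) = f,
        u \oc fmap Q (direct_sum_inr X X) = g &
        u \oc fmap Q (diagonal X) = h].

(* Triangles isomorphic to some K --f--> L --> Cone(f) --> K[1] *)
Definition derived_distinguished (X Y Z : derived_category)
    (u : hom X Y) (v : hom Y Z) (w : hom Z (derived_shift X)) : Prop :=
  exists (K L : complex A) (f : chain_map K L)
    (a : hom X (K : derived_category)) (b : hom Y (L : derived_category))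
    (c : hom Z (cone f : derived_category)),
    [/\ is_iso a, is_iso b & is_iso c] /\
    [/\ b \oc u = fmap Q f \oc a,
        c \oc v = fmap Q (cone_in f) \oc b &
        fmap derived_shift a \oc w = fmap Q (cone_out f) \oc c].

Definition derived_triangulated : triangulated_data :=
  @TriangulatedData derived_category
    derived_is_sum derived_shift derived_distinguished.

End DerivedCategory.

Record triangulated_functor (S T : triangulated_data) := TriangulatedFunctor {
  tfun :> functor S T;
  tfun_add : forall (x y : S) (f g h : hom x y),
    is_sum f g h -> is_sum (fmap tfun f) (fmap tfun g) (fmap tfun h);
  tfun_shift : nat_trans (comp_functor tfun (tshift S))
                         (comp_functor (tshift T) tfun);
  tfun_shift_iso : forall x, is_iso (tfun_shift x);
  tfun_distinguished : forall (x y z : S)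
      (u : hom x y) (v : hom y z) (w : hom z (tshift S x)),
    distinguished u v w ->
    distinguished (fmap tfun u) (fmap tfun v) (tfun_shift x \oc fmap tfun w)
}.

Definition triangulated_equivalent (S T : triangulated_data) : Prop :=
  exists F : triangulated_functor S T, is_equivalence F.

Definition universally_derived_equivalent (d d' : Order.disp_t)
    (P : porderType d) (Q : porderType d') : Prop :=
  forall A : abelian_category,
    triangulated_equivalent
      (derived_triangulated (functor_category P A))
      (derived_triangulated (functor_category Q A)).

Definition ordinal_sum (P Q : Type) : Type := (P + Q)%type.

Fact ordinal_sum_display (d d' : Order.disp_t) : Order.disp_t.
Proof. exact: d. Qed.

Section OrdinalSum.
Variables (d d' : Order.disp_t) (P : porderType d) (Q : porderType d').

HB.instance Definition _ := Choice.copy (ordinal_sum P Q) (P + Q)%type.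

Definition ordinal_sum_le (x y : ordinal_sum P Q) : bool :=
  match x, y with
  | inl p, inl p' => (p <= p')%O
  | inr q, inr q' => (q <= q')%O
  | inl _, inr _ => true
  | inr _, inl _ => false
  end.

Lemma ordinal_sum_le_refl : reflexive ordinal_sum_le.
Proof. by case=> p /=. Qed.

Lemma ordinal_sum_le_anti : antisymmetric ordinal_sum_le.
Proof. by move=> [p|q] [p'|q'] //= /le_anti ->. Qed.

Lemma ordinal_sum_le_trans : transitive ordinal_sum_le.
Proof. by move=> [p|q] [p'|q'] [p''|q''] //=; apply: le_trans. Qed.

HB.instance Definition _ := Order.Le_isPOrder.Build
  (ordinal_sum_display d d') (ordinal_sum P Q)
  ordinal_sum_le_refl ordinal_sum_le_anti ordinal_sum_le_trans.

End OrdinalSum.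

Notation one_poset := 'I_1.

(* Main.v *)
From mathcomp Require Import all_boot all_order all_algebra.
From mathcomp Require Import boolp.
Require Import Defs.

(** Write a diagram on [X (+) 1] as [F -> M], with [F] a diagram on [X], and one
    on [1 (+) X] as [N -> G]. On complexes put
      [S (F -> M) = (M -> Cone(F -> M))],  [T (N -> G) = (Cone(N -> G) -> N[1])].
    There are natural quasi-isomorphisms [K[1] -> T S K] and [S T L -> L[1]], and
    the shift is invertible, so [S] and [T] induce equivalences of derived
    categories. Both functors have the form [K |-> Cone(U K -> V K)] for a
    transformation [U -> V] of exact functors; such a functor preserves
    quasi-isomorphisms, commutes with the shift up to a sign on [U], and carries
    [Cone(f)] to the cone of the image of [f], so it is triangulated. Instead of
    homology objects one works with acyclicity of cones, tested on generalized
    elements [W -> X] up to epimorphic refinement of [W]. *)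

Set Implicit Arguments.
Unset Strict Implicit.
Unset Printing Implicit Defensive.

Import Order.TTheory GRing.Theory.
Local Open Scope ring_scope.
Local Open Scope cat_scope.

(** * Diagram chasing with generalized elements *)

Section GeneralizedElements.
Variable A : abelian_category.
Implicit Types x y z w : A.

(** At each point x of X, [S] and [T] rotate triangles. With C = Cone(F x -> M), the triangle F x ->
    M -> C -> F x[1] -> M[1] shows that [S] passes from the first map to the second and [T] from the
    second to the fourth. Up to sign the three rotations amount to the shift. One rotation turns a
    family of maps with common target M into one with common source M, and this exchanges the two
    posets. As [A] is arbitrary, no injective or projective resolutions are at hand. Hence nothing
    gets derived: only exact functors are applied, degree by degree, and a cone stands in for the
    non-exact cokernel. Morphisms of the derived category are classes of formal zigzags, so functors
    and natural maps are constructed on complexes and descend from there. The two composites are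
    total complexes of squares with one corner zero. Under [T S] it is the initial corner, so K is
    the kernel of what remains and maps in; under [S T] it is the final one, so L is the cokernel
    and receives a map. This gives the opposite directions of the two quasi-isomorphisms. *)

Definition cpair w x y (a : phom w x) (b : phom w y) : phom w (biprod x y) :=
  inl_ x y \op a + inr_ x y \op b.

Lemma prl_cpair w x y (a : phom w x) (b : phom w y) :
  prl_ x y \op cpair a b = a.
Proof. by rewrite pcompDr !pcompA prl_inl prl_inr pcomp1m pcomp0m addr0. Qed.

Lemma prr_cpair w x y (a : phom w x) (b : phom w y) :
  prr_ x y \op cpair a b = b.
Proof. by rewrite pcompDr !pcompA prr_inl prr_inr pcomp1m pcomp0m add0r. Qed.

Lemma cpair_eta w x y (z : phom w (biprod x y)) :
  z = cpair (prl_ x y \op z) (prr_ x y \op z).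
Proof. by apply: biprod_ext_pr; rewrite ?prl_cpair ?prr_cpair. Qed.

Lemma cpair_comp v w x y (a : phom w x) (b : phom w y) (z : phom v w) :
  cpair a b \op z = cpair (a \op z) (b \op z).
Proof. by rewrite /cpair pcompDl !pcompA. Qed.

Lemma cpairD w x y (a a' : phom w x) (b b' : phom w y) :
  cpair a b + cpair a' b' = cpair (a + a') (b + b').
Proof. by rewrite /cpair !pcompDr addrACA. Qed.

Lemma cpairN w x y (a : phom w x) (b : phom w y) :
  - cpair a b = cpair (- a) (- b).
Proof. by rewrite /cpair !pcompmN opprD. Qed.

Lemma cpair0 w x y : cpair (0 : phom w x) (0 : phom w y) = 0.
Proof. by rewrite /cpair !pcompm0 addr0. Qed.

Lemma cpair_inj w x y (a a' : phom w x) (b b' : phom w y) :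
  cpair a b = cpair a' b' -> a = a' /\ b = b'.
Proof.
move=> e; split.
  by rewrite -[a](prl_cpair a b) e prl_cpair.
by rewrite -[b](prr_cpair a b) e prr_cpair.
Qed.

Lemma cpair_eq0 w x y (a : phom w x) (b : phom w y) :
  cpair a b = 0 -> a = 0 /\ b = 0.
Proof. by rewrite -cpair0 => /cpair_inj. Qed.

Lemma inl_cpair w x y (a : phom w x) : inl_ x y \op a = cpair a 0.
Proof. by rewrite /cpair pcompm0 addr0. Qed.

Lemma inr_cpair w x y (b : phom w y) : inr_ x y \op b = cpair 0 b.
Proof. by rewrite /cpair pcompm0 add0r. Qed.

Lemma map_cpair w x y x' y' (f : phom x x') (g : phom y y')
    (a : phom w x) (b : phom w y) :
  biprod_map f g \op cpair a b = cpair (f \op a) (g \op b).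
Proof.
by apply: biprod_ext_pr; rewrite pcompA ?prl_map ?prr_map -pcompA
  ?prl_cpair ?prr_cpair.
Qed.

Lemma biprod_elt x y z (f g : phom (biprod x y) z) :
  (forall w (a : phom w x) (b : phom w y), f \op cpair a b = g \op cpair a b) ->
  f = g.
Proof. by move=> fg; rewrite -[f]pcompm1 -[g]pcompm1 (cpair_eta (pid _)) fg. Qed.

Lemma epi_pid x : is_epi (pid x).
Proof. by move=> w g h; rewrite !pcompm1. Qed.

Lemma epi_comp x y z (f : phom y z) (g : phom x y) :
  is_epi f -> is_epi g -> is_epi (f \op g).
Proof. by move=> fe ge w u v; rewrite !pcompA => /ge /fe. Qed.

Lemma epi_eq0 x y z (e : phom x y) (g : phom y z) :
  is_epi e -> g \op e = 0 -> g = 0.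
Proof. by move=> ee ge; apply: ee; rewrite pcomp0m. Qed.

Lemma mono_eq0 x y (m : phom x y) :
  (forall w (z : phom w x), m \op z = 0 -> z = 0) -> is_mono m.
Proof.
move=> m0 w g h gh; apply/eqP; rewrite -subr_eq0; apply/eqP/m0.
by rewrite pcompmB gh subrr.
Qed.

(** Epimorphisms are stable under pullback. The pullback is the kernel of the difference map [q],
    which is epi and so the cokernel of its kernel. A [g] killing the projection to [w] thus gives
    [u] with [u \op q = g \op prr_ x w]; then [u] kills [p], so [u = 0] and [g = 0]. *)
Lemma epi_lift x y w (p : phom x y) (z : phom w y) : is_epi p ->
  exists (w' : A) (e : phom w' w) (t : phom w' x), is_epi e /\ p \op t = z \op e.
Proof.
move=> pe; pose q : phom (biprod x w) y := p \op prl_ x w - z \op prr_ x w.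
have qe : is_epi q.
  move=> v g h gh; apply: pe; have := congr1 (fun t => t \op inl_ x w) gh.
  by rewrite /q -!pcompA !pcompBm -!pcompA prl_inl prr_inl !pcompm0 !subr0 !pcompm1.
exists (ker q), (prr_ x w \op kerm q), (prl_ x w \op kerm q); split; last first.
  by apply/eqP; rewrite -subr_eq0 !pcompA -pcompBm kermK.
move=> v; suff E (g : phom w v) : g \op (prr_ x w \op kerm q) = 0 -> g = 0.
  move=> g h gh; apply/eqP; rewrite -subr_eq0; apply/eqP/E.
  by rewrite pcompBm gh subrr.
rewrite pcompA => g0.
have [u [uq _]] := (epi_cokernel_ker qe).2 _ _ g0.
have up : u \op p = 0.
  have := congr1 (fun t => t \op inl_ x w) uq.
  rewrite /q -!pcompA pcompBm -!pcompA prl_inl prr_inl !pcompm0 subr0 pcompm1.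
  by [].
have u0 := epi_eq0 pe up.
by rewrite -[g]pcompm1 -(prr_inr x w) pcompA -uq u0 !pcomp0m.
Qed.

Lemma to_zero w x (f : phom w x) : pid x = 0 -> f = 0.
Proof. by move=> x0; rewrite -[f]pcomp1m x0 pcomp0m. Qed.

(** Only the inclusion of the kernel of [g] in the image of [f], a preimage being allowed to exist
    after an epimorphic cover [e]. The condition [g \op f = 0] is kept separate. *)
Definition exact x y z (f : phom x y) (g : phom y z) : Prop :=
  forall w (a : phom w y), g \op a = 0 ->
  exists (w' : A) (e : phom w' w) (b : phom w' x),
    is_epi e /\ a \op e = f \op b.

Lemma exactP x y z (f : phom x y) (g : phom y z) (gf0 : g \op f = 0) :
  exact f g <-> is_epi (ker_lift gf0).
Proof.
split=> [fg|le w a ga0].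
  have [w [e [b [ee eb]]]] := fg _ _ (kermK g).
  have {}eb : e = ker_lift gf0 \op b.
    by apply: kerm_mono; rewrite eb pcompA ker_liftK.
  by move=> v u t ut; apply: ee; rewrite eb !pcompA ut.
have [w' [e [b [ee eb]]]] := epi_lift (ker_lift ga0) le.
exists w', e, b; split=> //.
by rewrite -(ker_liftK ga0) -pcompA -eb pcompA ker_liftK.
Qed.

(** Image and coimage agree. If [g] kills the map [p] into the kernel [m] of the cokernel, then [f]
    factors through the smaller subobject [m \op k]. The cokernel of the latter kills [f], hence
    [m], so [m] factors through [m \op k]; then [k] has a section and [g = 0]. *)
Lemma exact_coker x y (f : phom x y) : exact f (cokerm f).
Proof.
apply/(exactP (cokermK f)).
set p := ker_lift _; pose m := kerm (cokerm f).
have mp : m \op p = f by apply: ker_liftK.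
move=> v; suff E (g : phom (ker (cokerm f)) v) : g \op p = 0 -> g = 0.
  move=> g h gh; apply/eqP; rewrite -subr_eq0; apply/eqP/E.
  by rewrite pcompBm gh subrr.
move=> gp; pose k := kerm g.
have mk : is_mono (m \op k).
  by move=> w s t; rewrite -!pcompA => /kerm_mono /kerm_mono.
have cf : cokerm (m \op k) \op f = 0.
  have ef : m \op k \op ker_lift gp = f by rewrite -pcompA ker_liftK mp.
  by have := congr1 (fun t => cokerm (m \op k) \op t) ef; rewrite pcompA cokermK pcomp0m.
have cm : cokerm (m \op k) \op m = 0.
  by rewrite -(coker_descK cf) -pcompA kermK pcompm0.
have [t [mt _]] := (mono_kernel_coker mk).2 _ _ cm.
have kt : k \op t = pid _ by apply: kerm_mono; rewrite pcompA mt pcompm1.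
by rewrite -[g]pcompm1 -kt pcompA kermK pcomp0m.
Qed.

Lemma epi_elt x y (p : phom x y) :
  (forall w (z : phom w y), exists (w' : A) (e : phom w' w) (t : phom w' x),
    is_epi e /\ z \op e = p \op t) -> is_epi p.
Proof.
move=> ph; have [w [e [t [ee et]]]] := ph _ (pid y).
by move=> v g h gh; apply: ee; rewrite -[e]pcomp1m et !pcompA gh.
Qed.

Lemma mono_epi_iso x y (f : phom x y) :
  is_mono f -> is_epi f -> @is_iso A _ _ f.
Proof.
move=> fm fe; have fc : cokerm f \op pid y = 0.
  by rewrite pcompm1; apply/epi_coker0.
have [g [fg _]] := (mono_kernel_coker fm).2 _ _ fc.
by exists g; split=> //=; apply: fm; rewrite pcompA fg pcomp1m pcompm1.
Qed.

Lemma iso_mono_epi x y (f : phom x y) :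
  @is_iso A _ _ f -> is_mono f /\ is_epi f.
Proof.
case=> g [/= gf fg]; split=> w u v uv.
  by rewrite -[u]pcomp1m -[v]pcomp1m -gf -!pcompA uv.
by rewrite -[u]pcompm1 -[v]pcompm1 -fg !pcompA uv.
Qed.

(** * Homology classes of generalized cycles *)

Section HomologyElements.
Variables (x y z : A) (f : phom x y) (g : phom y z) (gf0 : g \op f = 0).

Definition hclass w (a : phom w y) (ga0 : g \op a = 0) : phom w (homology gf0) :=
  cokerm (ker_lift gf0) \op ker_lift ga0.

Lemma hclass_eq0 w (a : phom w y) (ga0 : g \op a = 0) :
  hclass ga0 = 0 <->
  exists (w' : A) (e : phom w' w) (b : phom w' x), is_epi e /\ a \op e = f \op b.
Proof.
split=> [/exact_coker [w' [e [b [ee eb]]]]|[w' [e [b [ee eb]]]]].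
  exists w', e, b; split=> //.
  by rewrite -(ker_liftK ga0) -pcompA eb pcompA ker_liftK.
apply: (epi_eq0 ee); rewrite /hclass -pcompA.
suff -> : ker_lift ga0 \op e = ker_lift gf0 \op b by rewrite pcompA cokermK pcomp0m.
by apply: kerm_mono; rewrite !pcompA !ker_liftK.
Qed.

Lemma hclass_surj w (h : phom w (homology gf0)) :
  exists (w' : A) (e : phom w' w) (a : phom w' y) (ga0 : g \op a = 0),
    is_epi e /\ h \op e = hclass ga0.
Proof.
have [w' [e [t [ee et]]]] := epi_lift h (@cokerm_epi _ _ _ (ker_lift gf0)).
have ga0 : g \op (kerm g \op t) = 0 by rewrite pcompA kermK pcomp0m.
exists w', e, (kerm g \op t), ga0; split=> //; rewrite -et; congr (_ \op _).
by apply: kerm_mono; rewrite ker_liftK.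
Qed.

End HomologyElements.

Lemma homology_map_hclass (x y z x' y' z' : A)
    (f : phom x y) (g : phom y z) (gf0 : g \op f = 0)
    (f' : phom x' y') (g' : phom y' z') (gf0' : g' \op f' = 0)
    a b c (ba : b \op f = f' \op a) (cb : c \op g = g' \op b)
    w (t : phom w y) (gt0 : g \op t = 0) (gt0' : g' \op (b \op t) = 0) :
  homology_map gf0 gf0' ba cb \op hclass gf0 gt0 = hclass gf0' gt0'.
Proof.
rewrite /hclass pcompA homology_mapK -pcompA; congr (_ \op _).
by apply: kerm_mono; rewrite pcompA cycles_mapK -pcompA !ker_liftK.
Qed.

Lemma hclassB (x y z : A) (f : phom x y) (g : phom y z) (gf0 : g \op f = 0)
    w (s t : phom w y) (s0 : g \op s = 0) (t0 : g \op t = 0)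
    (st0 : g \op (s - t) = 0) :
  hclass gf0 st0 = hclass gf0 s0 - hclass gf0 t0.
Proof.
rewrite /hclass -pcompmB; congr (_ \op _).
by apply: kerm_mono; rewrite pcompmB !ker_liftK.
Qed.

Lemma hclass_comp (x y z : A) (f : phom x y) (g : phom y z) (gf0 : g \op f = 0)
    v w (s : phom w y) (e : phom v w) (s0 : g \op s = 0)
    (se0 : g \op (s \op e) = 0) :
  hclass gf0 s0 \op e = hclass gf0 se0.
Proof.
rewrite /hclass -pcompA; congr (_ \op _).
by apply: kerm_mono; rewrite pcompA !ker_liftK.
Qed.

End GeneralizedElements.

(** * Quasi-isomorphisms and cones *)

Lemma succz_surj n : exists m, n = succz m.
Proof. by exists (n - 1); rewrite /succz subrK. Qed.

Section Acyclicity.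
Variable A : abelian_category.
Implicit Types X Y Z : complex A.

Definition acyclic X : Prop := forall n, exact (cx_d X n) (cx_d X (succz n)).

Lemma cone_d_cpair X Y (f : chain_map X Y) n w
    (a : phom w (X (succz n))) (b : phom w (Y n)) :
  cone_d f n \op cpair a b =
    cpair (- (cx_d X (succz n) \op a)) (f (succz n) \op a + cx_d Y n \op b).
Proof.
rewrite /cone_d pcompDl -!pcompA pcompDl -!pcompA prl_cpair prr_cpair.
by rewrite pcompNm.
Qed.

Lemma prl_cone_d X Y (f : chain_map X Y) n :
  prl_ _ _ \op cx_d (cone f) n = - (cx_d X (succz n) \op prl_ _ _).
Proof.
by rewrite -[cx_d _ _]pcompm1 (cpair_eta (pid _)) cone_d_cpair !pcompm1 prl_cpair.
Qed.

Lemma prr_cone_d X Y (f : chain_map X Y) n :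
  prr_ _ _ \op cx_d (cone f) n = f (succz n) \op prl_ _ _ + cx_d Y n \op prr_ _ _.
Proof.
by rewrite -[cx_d _ _]pcompm1 (cpair_eta (pid _)) cone_d_cpair !pcompm1 prr_cpair.
Qed.

(** Acyclicity of a cone in components, the form in which it is checked below. *)
Lemma acyclic_coneP X Y (f : chain_map X Y) :
  acyclic (cone f) <->
  forall n w (x : phom w (X (succz (succz n)))) (y : phom w (Y (succz n))),
    cx_d X (succz (succz n)) \op x = 0 ->
    f (succz (succz n)) \op x + cx_d Y (succz n) \op y = 0 ->
    exists (w' : A) (e : phom w' w) (x0 : phom w' (X (succz n))) (y0 : phom w' (Y n)),
      [/\ is_epi e, - (cx_d X (succz n) \op x0) = x \op e &
          f (succz n) \op x0 + cx_d Y n \op y0 = y \op e].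
Proof.
split=> [ac n w x y dx0 dy0|ac n w z].
  have [|w' [e [b [ee]]]] := ac n w (cpair x y).
    rewrite cone_d_cpair dx0 dy0 oppr0; exact: cpair0.
  rewrite [b]cpair_eta cone_d_cpair cpair_comp => /cpair_inj[ex ey].
  by exists w', e, (prl_ _ _ \op b), (prr_ _ _ \op b).
rewrite [z]cpair_eta /= cone_d_cpair => /cpair_eq0[/eqP]; rewrite oppr_eq0.
move=> /eqP dx0 dy; have [w' [e [x0 [y0 [ee ex ey]]]]] := ac n w _ _ dx0 dy.
by exists w', e, (cpair x0 y0); split=> //; rewrite cone_d_cpair cpair_comp ex ey.
Qed.

(** A retract of an acyclic complex is acyclic: move the cycle to [X] by [g], bound it there, and
    return by [f]. *)
Lemma acyclic_iso X Y (f : chain_map X Y) (g : chain_map Y X) :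
  chain_comp f g = chain_id Y -> acyclic X -> acyclic Y.
Proof.
move=> fg aX n w z dz0.
have fgn m : f m \op g m = pid (Y m).
  exact: (congr1 (fun h : chain_map Y Y => h m) fg).
have [|w' [e [b [ee eb]]]] := aX n w (g (succz n) \op z).
  by rewrite pcompA -cm_d -pcompA dz0 pcompm0.
exists w', e, (f n \op b); split=> //.
by rewrite -[z]pcomp1m -fgn -(pcompA _ _ z) -pcompA eb !pcompA cm_d.
Qed.

(** After refinement every element of homology is the class of a cycle ([hclass_surj]), and the
    class vanishes exactly when the cycle bounds after refinement ([hclass_eq0]). The translation
    here and in [quasi_iso_epi] rests on these two facts. *)
Lemma quasi_iso_mono X Y (f : chain_map X Y) n :
  is_mono (cohomology_map f n) <->
  forall w (x : phom w (X (succz n))) (y : phom w (Y n)),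
    cx_d X (succz n) \op x = 0 -> f (succz n) \op x = cx_d Y n \op y ->
    exists (w' : A) (e : phom w' w) (t : phom w' (X n)),
      is_epi e /\ x \op e = cx_d X n \op t.
Proof.
split=> [fm w x y dx0 fx|fm].
  apply/(hclass_eq0 (cx_dd X n) dx0).
  have dfx0 : cx_d Y (succz n) \op (f (succz n) \op x) = 0.
    by rewrite fx pcompA cx_dd pcomp0m.
  apply: fm; rewrite pcompm0 /cohomology_map (homology_map_hclass _ _ _ _ _ dfx0).
  apply/hclass_eq0; exists w, (pid w), y; split; first exact: epi_pid.
  by rewrite pcompm1.
apply: mono_eq0 => w z fz0.
have [w1 [e1 [x [dx0 [ee1 ex]]]]] := hclass_surj z.
have dfx0 : cx_d Y (succz n) \op (f (succz n) \op x) = 0.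
  by rewrite pcompA -cm_d -pcompA dx0 pcompm0.
have /hclass_eq0[w2 [e2 [y [ee2 ey]]]] : hclass (cx_dd Y n) dfx0 = 0.
  rewrite -(homology_map_hclass (cx_dd X n) _ (cm_d f n) (cm_d f _) dx0).
  by rewrite -ex pcompA fz0 pcomp0m.
have dxe0 : cx_d X (succz n) \op (x \op e2) = 0 by rewrite pcompA dx0 pcomp0m.
have [|w3 [e3 [t [ee3 et]]]] := fm _ (x \op e2) y dxe0; first by rewrite pcompA.
apply: (epi_eq0 ee1); rewrite ex; apply/hclass_eq0.
exists w3, (e2 \op e3), t; split; first exact: epi_comp.
by rewrite pcompA.
Qed.

Lemma quasi_iso_epi X Y (f : chain_map X Y) n :
  is_epi (cohomology_map f n) <->
  forall w (y : phom w (Y (succz n))), cx_d Y (succz n) \op y = 0 ->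
    exists (w' : A) (e : phom w' w) (x : phom w' (X (succz n))) (t : phom w' (Y n)),
      [/\ is_epi e, cx_d X (succz n) \op x = 0 &
          y \op e = f (succz n) \op x + cx_d Y n \op t].
Proof.
split=> [fe w y dy0|fe].
  have [w1 [e1 [z [ee1 ez]]]] := epi_lift (hclass (cx_dd Y n) dy0) fe.
  have [w2 [e2 [x [dx0 [ee2 ex]]]]] := hclass_surj z.
  have dfx0 : cx_d Y (succz n) \op (f (succz n) \op x) = 0.
    by rewrite pcompA -cm_d -pcompA dx0 pcompm0.
  have dye0 : cx_d Y (succz n) \op (y \op (e1 \op e2)) = 0.
    by rewrite pcompA dy0 pcomp0m.
  have d0 : cx_d Y (succz n) \op (y \op (e1 \op e2) - f (succz n) \op x) = 0.
    by rewrite pcompmB dye0 dfx0 subrr.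
  have /hclass_eq0[w3 [e3 [t [ee3 et]]]] : hclass (cx_dd Y n) d0 = 0.
    rewrite (hclassB _ dye0 dfx0) -(hclass_comp _ dy0) pcompA -ez -pcompA ex.
    by rewrite (homology_map_hclass _ _ _ _ _ dfx0) subrr.
  exists w3, (e1 \op (e2 \op e3)), (x \op e3), t; split.
  - by apply: epi_comp => //; apply: epi_comp.
  - by rewrite pcompA dx0 pcomp0m.
  by rewrite -et pcompBm -!pcompA addrC subrK.
apply: epi_elt => w z.
have [w1 [e1 [y [dy0 [ee1 ey]]]]] := hclass_surj z.
have [w2 [e2 [x [t [ee2 dx0 et]]]]] := fe _ y dy0.
have dfx0 : cx_d Y (succz n) \op (f (succz n) \op x) = 0.
  by rewrite pcompA -cm_d -pcompA dx0 pcompm0.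
have dye0 : cx_d Y (succz n) \op (y \op e2) = 0 by rewrite pcompA dy0 pcomp0m.
exists w2, (e1 \op e2), (hclass (cx_dd X n) dx0); split; first exact: epi_comp.
rewrite (homology_map_hclass _ _ _ _ _ dfx0) pcompA ey (hclass_comp _ dy0 dye0).
have d0 : cx_d Y (succz n) \op (y \op e2 - f (succz n) \op x) = 0.
  by rewrite pcompmB dye0 dfx0 subrr.
apply/eqP; rewrite -subr_eq0 -(hclassB _ _ _ d0); apply/eqP/hclass_eq0.
exists w2, (pid w2), t; split; first exact: epi_pid.
by rewrite pcompm1 et addrC addKr.
Qed.

(** This replaces the long exact sequence of the cone. For a cone cycle (x, y), injectivity on the
    cohomology of degree n + 2 bounds x, because f x = d(- y); the corrected y is then a cycle, and
    surjectivity in degree n + 1 finishes. *)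
Lemma quasi_isoP X Y (f : chain_map X Y) : quasi_iso f <-> acyclic (cone f).
Proof.
split=> [fq|/acyclic_coneP ac n].
  apply/acyclic_coneP => n w x y dx0 dy.
  have [fm _] := iso_mono_epi (fq (succz n)).
  have [_ fe] := iso_mono_epi (fq n).
  have [|w1 [e1 [x1 [ee1 ex1]]]] := (quasi_iso_mono f (succz n)).1 fm _ x (- y) dx0.
    by apply/eqP; rewrite pcompmN -subr_eq0 opprK dy.
  have [|w2 [e2 [x2 [t [ee2 dx2 et]]]]] :=
      (quasi_iso_epi f n).1 fe _ (y \op e1 + f (succz n) \op x1).
    rewrite pcompDr !pcompA -cm_d -[_ \op x1]pcompA -ex1 [_ \op (x \op e1)]pcompA.
    by rewrite -pcompDl addrC dy pcomp0m.
  exists w2, (e1 \op e2), (x2 - x1 \op e2), t; split; first exact: epi_comp.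
    by rewrite pcompmB dx2 sub0r opprK !pcompA ex1.
  by rewrite pcompmB addrAC -et pcompDl -!pcompA addrK.
apply: mono_epi_iso.
  (* The cone in degree m + 1 has its first component in degree m + 2, so injectivity in degree n +
     1 calls for n = m + 1. *)
  have [m ->] := succz_surj n.
  apply/quasi_iso_mono => w x y dx0 fx.
  have [||w' [e [x0 [y0 [ee ex _]]]]] := ac m w x (- y) => //.
    by rewrite fx pcompmN subrr.
  by exists w', e, (- x0); rewrite pcompmN ex.
apply/quasi_iso_epi => w y dy0.
have [||w' [e [x0 [y0 [ee ex ey]]]]] := ac n w 0 y.
- by rewrite pcompm0.
- by rewrite pcompm0 add0r.
exists w', e, x0, y0; split=> //.
by apply/eqP; rewrite -oppr_eq0 ex pcomp0m.
Qed.

End Acyclicity.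

(** * The cone of a transformation of exact functors *)

Record exact_functor (A B : abelian_category) := ExactFunctor {
  eob :> A -> B;
  emap : forall x y, phom x y -> phom (eob x) (eob y);
  emap1 : forall x, emap (pid x) = pid (eob x);
  emapM : forall x y z (g : phom y z) (f : phom x y),
    emap (g \op f) = emap g \op emap f;
  emapD : forall x y (f g : phom x y), emap (f + g) = emap f + emap g;
  emap_exact : forall x y z (f : phom x y) (g : phom y z),
    g \op f = 0 -> exact f g -> exact (emap f) (emap g)
}.
Arguments emap {A B} e {x y}.

Record exact_trans (A B : abelian_category) (U V : exact_functor A B) :=
  ExactTrans {
  et_app :> forall x, phom (U x) (V x);
  et_nat : forall x y (f : phom x y), et_app y \op emap U f = emap V f \op et_app x
}.

Section ExactFunctorTheory.
Variables (A B : abelian_category) (U : exact_functor A B).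

Lemma emap0 x y : emap U (0 : phom x y) = 0.
Proof. by apply: (addrI (emap U 0)); rewrite -emapD !addr0. Qed.

Lemma emapN x y (f : phom x y) : emap U (- f) = - emap U f.
Proof. by apply: (addrI (emap U f)); rewrite -emapD !subrr emap0. Qed.

Lemma emap_app x y z (g : phom y z) (f : phom x y) w (a : phom w (U x)) :
  emap U g \op (emap U f \op a) = emap U (g \op f) \op a.
Proof. by rewrite pcompA emapM. Qed.

Lemma emap_biprod (x y : A) w (z : phom w (U (biprod x y))) :
  z = emap U (inl_ _ _) \op (emap U (prl_ _ _) \op z) +
      emap U (inr_ _ _) \op (emap U (prr_ _ _) \op z).
Proof. by rewrite !emap_app -pcompDl -emapD biprod_id emap1 pcomp1m. Qed.

Definition emap_complex (X : complex A) : complex B.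
Proof.
exists (fun n => U (X n)) (fun n => emap U (cx_d X n)) => n.
by rewrite -emapM cx_dd emap0.
Defined.

Lemma emap_acyclic X : acyclic X -> acyclic (emap_complex X).
Proof. by move=> aX n; apply: emap_exact; [apply: cx_dd|apply: aX]. Qed.

End ExactFunctorTheory.

Lemma cone_acyclic (B : abelian_category) (X Y : complex B) (f : chain_map X Y) :
  acyclic X -> acyclic Y -> acyclic (cone f).
Proof.
move=> aX aY; apply/acyclic_coneP => n w x y dx0 dy.
have [w1 [e1 [x1 [ee1 ex1]]]] := aX _ _ _ dx0.
have [|w2 [e2 [y2 [ee2 ey2]]]] := aY n _ (y \op e1 + f (succz n) \op x1).
  rewrite pcompDr !pcompA -cm_d -[_ \op x1]pcompA -ex1 [_ \op (x \op e1)]pcompA.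
  by rewrite -pcompDl addrC dy pcomp0m.
exists w2, (e1 \op e2), (- (x1 \op e2)), y2; split; first exact: epi_comp.
  by rewrite pcompmN opprK !pcompA ex1.
by rewrite -ey2 pcompmN pcompDl -!pcompA addrC addrK.
Qed.

Lemma chain_inv (B : abelian_category) (X Y : complex B) (f : chain_map X Y)
    (g : forall n, phom (Y n) (X n)) :
  (forall n, g n \op f n = pid _) -> (forall n, f n \op g n = pid _) ->
  exists h : chain_map Y X, chain_comp h f = chain_id X /\ chain_comp f h = chain_id Y.
Proof.
move=> gf fg; have gd n : g (succz n) \op cx_d Y n = cx_d X n \op g n.
  rewrite -[LHS]pcompm1 -fg pcompA -(pcompA _ _ (f n)) -cm_d !pcompA gf.
  by rewrite pcomp1m.
by exists (ChainMap gd); split; apply: chain_map_ext => n /=.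
Qed.

Section ConeFunctor.
Variables (A B : abelian_category) (U V : exact_functor A B).
Variable tau : exact_trans U V.
Implicit Types X Y Z : complex A.

Lemma et_app_nat x y (f : phom x y) w (a : phom w (U x)) :
  tau y \op (emap U f \op a) = emap V f \op (tau x \op a).
Proof. by rewrite pcompA et_nat pcompA. Qed.

Definition et_map X : chain_map (emap_complex U X) (emap_complex V X).
Proof. by exists (fun n => tau (X n)) => n; apply: et_nat. Defined.

Definition scone X : complex B := cone (et_map X).

Lemma scone_d_cpair X n w (a : phom w (U (X (succz n)))) (b : phom w (V (X n))) :
  cx_d (scone X) n \op cpair a b =
  cpair (- (emap U (cx_d X (succz n)) \op a))
        (tau (X (succz n)) \op a + emap V (cx_d X n) \op b).
Proof. exact: cone_d_cpair. Qed.

Definition scone_map X Y (f : chain_map X Y) : chain_map (scone X) (scone Y).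
Proof.
exists (fun n => biprod_map (emap U (f (succz n))) (emap V (f n))) => n.
apply: biprod_elt => w a b.
rewrite -!pcompA scone_d_cpair !map_cpair scone_d_cpair !pcompmN pcompDr /=.
congr cpair; first by rewrite !emap_app cm_d.
by congr (_ + _); rewrite ?et_app_nat // !emap_app cm_d.
Defined.

Lemma scone_map1 X : scone_map (chain_id X) = chain_id (scone X).
Proof. by apply: chain_map_ext => n /=; rewrite !emap1 biprod_map1. Qed.

Lemma scone_mapM X Y Z (g : chain_map Y Z) (f : chain_map X Y) :
  scone_map (chain_comp g f) = chain_comp (scone_map g) (scone_map f).
Proof. by apply: chain_map_ext => n /=; rewrite !emapM biprod_mapM. Qed.

Definition scone_functor : functor (complex_category A) (complex_category B) :=
  @Functor (complex_category A) (complex_category B)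
    scone scone_map scone_map1 scone_mapM.

Lemma scone_acyclic X : acyclic X -> acyclic (scone X).
Proof. by move=> aX; apply: cone_acyclic; apply: emap_acyclic. Qed.

(* The sign on U(X^{n+2}) comes from the two shifts through which it is reached. *)
Definition scone_cone_app X Y (f : chain_map X Y) n :
    phom (scone (cone f) n) (cone (scone_map f) n) := cpair
  (cpair (- (emap U (prl_ _ _) \op prl_ _ _)) (emap V (prl_ _ _) \op prr_ _ _))
  (cpair (emap U (prr_ _ _) \op prl_ _ _) (emap V (prr_ _ _) \op prr_ _ _)).

Lemma scone_cone_cpair X Y (f : chain_map X Y) n w
    (a : phom w (U (cone f (succz n)))) (b : phom w (V (cone f n))) :
  scone_cone_app f n \op cpair a b = cpair
    (cpair (- (emap U (prl_ _ _) \op a)) (emap V (prl_ _ _) \op b))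
    (cpair (emap U (prr_ _ _) \op a) (emap V (prr_ _ _) \op b)).
Proof.
by rewrite !cpair_comp pcompNm -!pcompA prl_cpair prr_cpair.
Qed.

Definition scone_cone X Y (f : chain_map X Y) :
  chain_map (scone (cone f)) (cone (scone_map f)).
Proof.
exists (scone_cone_app f) => n.
apply: biprod_elt => w a b.
rewrite -!(pcompA _ _ (cpair a b)) scone_d_cpair !scone_cone_cpair cone_d_cpair.
rewrite scone_d_cpair map_cpair scone_d_cpair cpairN cpairD.
congr (cpair (cpair _ _) (cpair _ _)).
- by rewrite !pcompmN !opprK !emap_app prl_cone_d emapN pcompNm.
- rewrite pcompDr pcompmN opprD opprK -et_app_nat; congr (_ + _).
  by rewrite !emap_app prl_cone_d emapN pcompNm.
- rewrite !pcompmN !emap_app prr_cone_d emapD pcompDl opprD.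
  by congr (_ + _).
rewrite pcompDr -et_app_nat !emap_app prr_cone_d emapD pcompDl.
by rewrite addrCA.
Defined.

Lemma scone_cone_inv X Y (f : chain_map X Y) :
  exists g : chain_map (cone (scone_map f)) (scone (cone f)),
    chain_comp g (scone_cone f) = chain_id _ /\
    chain_comp (scone_cone f) g = chain_id _.
Proof.
pose g n : phom (cone (scone_map f) n) (scone (cone f) n) := cpair
  (emap U (inr_ _ _) \op (prl_ _ _ \op prr_ _ _) -
   emap U (inl_ _ _) \op (prl_ _ _ \op prl_ _ _))
  (emap V (inl_ _ _) \op (prr_ _ _ \op prl_ _ _) +
   emap V (inr_ _ _) \op (prr_ _ _ \op prr_ _ _)).
have gE n w a b a' b' : g n \op (cpair (cpair a b) (cpair a' b') : phom w _) = cpair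
    (emap U (inr_ _ _) \op a' - emap U (inl_ _ _) \op a)
    (emap V (inl_ _ _) \op b + emap V (inr_ _ _) \op b').
  rewrite cpair_comp pcompBm pcompDl -!pcompA !prl_cpair !prr_cpair.
  by rewrite !prl_cpair ?prr_cpair.
apply: (chain_inv (g := g)) => n; apply: biprod_elt => w a b.
  rewrite -pcompA scone_cone_cpair gE pcomp1m; congr cpair.
    rewrite pcompmN opprK addrC !emap_app -pcompDl -emapD biprod_id.
    by rewrite emap1 pcomp1m.
  by rewrite !emap_app -pcompDl -emapD biprod_id emap1 pcomp1m.
rewrite [a]cpair_eta [b]cpair_eta -pcompA gE scone_cone_cpair pcomp1m.
by congr (cpair (cpair _ _) (cpair _ _));
  rewrite ?pcompDr ?pcompBm ?pcompmB ?pcompmN !emap_app ?prl_inl ?prl_inr ?prr_inl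
  ?prr_inr ?emap0 ?emap1 ?pcomp0m ?pcomp1m ?addr0 ?add0r ?sub0r ?subr0 ?opprK.
Qed.

(** Acyclicity of [cone f] is preserved by the functor, and [scone_cone] carries it over to the cone
    of the image. *)
Lemma scone_quasi_iso X Y (f : chain_map X Y) :
  quasi_iso f -> quasi_iso (scone_map f).
Proof.
have [g [_ fg]] := scone_cone_inv f.
by move=> /quasi_isoP/scone_acyclic fa; apply/quasi_isoP/(acyclic_iso fg).
Qed.

(** Shifting a cone negates its whole differential, including the component [tau], which keeps its
    sign in the cone built from the shifted complex. The sign on the [U] part makes up for this. *)
Definition scone_shift X :
  chain_map (scone (shift_complex X)) (shift_complex (scone X)).
Proof.
exists (fun n => biprod_map (- pid _) (pid _)) => n.
apply: biprod_elt => w a b.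
rewrite -!(pcompA _ _ (cpair a b)) scone_d_cpair map_cpair.
rewrite [biprod_map _ _ \op _]map_cpair.
have -> : cx_d (shift_complex (scone X)) n = - cx_d (scone X) (succz n) by [].
rewrite !pcompNm !pcomp1m scone_d_cpair cpairN /= !emapN !pcompNm !pcompmN.
by rewrite !opprK opprD opprK.
Defined.

Lemma scone_shift_nat X Y (f : chain_map X Y) :
  chain_comp (scone_shift Y) (scone_map (shift_map f)) =
  chain_comp (shift_map (scone_map f)) (scone_shift X).
Proof.
apply: chain_map_ext => n; apply: biprod_elt => w a b /=.
by rewrite -!pcompA !map_cpair !pcomp1m !pcompNm !pcomp1m pcompmN.
Qed.

Lemma scone_shift_inv X :
  exists g : chain_map (shift_complex (scone X)) (scone (shift_complex X)),
    chain_comp g (scone_shift X) = chain_id _ /\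
    chain_comp (scone_shift X) g = chain_id _.
Proof.
pose g n : phom (shift_complex (scone X) n) (scone (shift_complex X) n) :=
  biprod_map (- pid _) (pid _).
apply: (chain_inv (g := g)) => n; apply: biprod_elt => w a b.
  by rewrite -pcompA !map_cpair !pcomp1m !pcompNm !pcomp1m opprK.
by rewrite -pcompA !map_cpair !pcomp1m !pcompNm !pcomp1m opprK.
Qed.

(** Together with [scone_cone_out], this identifies the image of the standard triangle of [f] with
    the standard triangle of [scone_map f]. *)
Lemma scone_cone_in X Y (f : chain_map X Y) :
  chain_comp (scone_cone f) (scone_map (cone_in f)) = cone_in (scone_map f).
Proof.
apply: chain_map_ext => n; apply: biprod_elt => w a b /=.
rewrite -!pcompA map_cpair scone_cone_cpair !emap_app.
rewrite !prl_inr !prr_inr !emap0 !emap1 !pcomp0m !pcomp1m oppr0 cpair0.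
by rewrite inr_cpair.
Qed.

Lemma scone_cone_out X Y (f : chain_map X Y) :
  chain_comp (scone_shift X) (scone_map (cone_out f)) =
  chain_comp (cone_out (scone_map f)) (scone_cone f).
Proof.
apply: chain_map_ext => n; apply: biprod_elt => w a b /=.
rewrite -!pcompA !map_cpair scone_cone_cpair prl_cpair.
by rewrite pcomp1m pcompNm pcomp1m.
Qed.

Definition chain_add (C : abelian_category) (X Y : complex C) (f g : chain_map X Y) :
  chain_map X Y.
Proof.
by exists (fun n => f n + g n) => n; rewrite pcompDl pcompDr !cm_d.
Defined.

Lemma scone_mapD X Y (f g : chain_map X Y) :
  scone_map (chain_add f g) = chain_add (scone_map f) (scone_map g).
Proof.
apply: chain_map_ext => n; apply: biprod_elt => w a b /=.
by rewrite pcompDl !map_cpair cpairD !emapD !pcompDl.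
Qed.

End ConeFunctor.

(** * Functors between derived categories *)

Section Isomorphisms.
Variables (C D : category).

Lemma iso_comp (x y z : C) (g : hom y z) (f : hom x y) :
  is_iso g -> is_iso f -> is_iso (g \oc f).
Proof.
case=> [g' [g'g gg']] [f' [f'f ff']]; exists (f' \oc g'); split.
  by rewrite -compA [g' \oc _]compA g'g comp1m.
by rewrite -compA [f \oc _]compA ff' comp1m.
Qed.

Lemma iso_fmap (F : functor C D) (x y : C) (f : hom x y) :
  is_iso f -> is_iso (fmap F f).
Proof.
by case=> [g [gf fg]]; exists (fmap F g); rewrite -!fmapM gf fg !fmap1.
Qed.

End Isomorphisms.

Lemma nat_iso_sym (C D : category) (F G : functor C D) : nat_iso F G -> nat_iso G F.
Proof.
case=> t ti; pose s x := projT1 (cid (ti x)).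
have st x : s x \oc t x = idm _ by case: (projT2 (cid (ti x))).
have ts x : t x \oc s x = idm _ by case: (projT2 (cid (ti x))).
have sn x y (f : hom x y) : s y \oc fmap G f = fmap F f \oc s x.
  by rewrite -[LHS]compm1 -ts compA -[_ \oc _ \oc t x]compA -nt_nat compA st comp1m.
by exists (NatTrans sn) => x; exists (t x).
Qed.

Lemma nat_iso_trans (C D : category) (F G H : functor C D) :
  nat_iso F G -> nat_iso G H -> nat_iso F H.
Proof.
case=> [t ti] [s si].
have n x y (f : hom x y) : (s y \oc t y) \oc fmap F f = fmap H f \oc (s x \oc t x).
  by rewrite -compA nt_nat compA nt_nat -compA.
by exists (NatTrans n) => x; apply: iso_comp.
Qed.

Lemma nat_iso_compl (C D E : category) (H : functor D E) (F G : functor C D) :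
  nat_iso F G -> nat_iso (comp_functor H F) (comp_functor H G).
Proof.
case=> t ti.
have n x y (f : hom x y) : fmap H (t y) \oc fmap (comp_functor H F) f =
    fmap (comp_functor H G) f \oc fmap H (t x).
  by rewrite /= -!fmapM nt_nat.
exists (@NatTrans _ _ (comp_functor H F) (comp_functor H G)
  (fun x => fmap H (t x)) n) => x /=; exact/iso_fmap/ti.
Qed.

Lemma nat_iso_compr (C D E : category) (F G : functor D E) (H : functor C D) :
  nat_iso F G -> nat_iso (comp_functor F H) (comp_functor G H).
Proof.
case=> t ti.
have n x y (f : hom x y) : t (H y) \oc fmap (comp_functor F H) f =
    fmap (comp_functor G H) f \oc t (H x) by exact: (nt_nat t (fmap H f)).
exists (@NatTrans _ _ (comp_functor F H) (comp_functor G H)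
  (fun x => t (H x)) n) => x; exact: ti.
Qed.

Lemma nat_iso_idl (C D : category) (F : functor C D) :
  nat_iso (comp_functor (id_functor D) F) F.
Proof.
have n x y (f : hom x y) : idm (F y) \oc fmap (comp_functor (id_functor D) F) f =
  fmap F f \oc idm (F x) by rewrite comp1m compm1.
exists (@NatTrans _ _ (comp_functor (id_functor D) F) F (fun x => idm (F x)) n) => x.
by exists (idm (F x)); rewrite !comp1m.
Qed.

Lemma nat_iso_idr (C D : category) (F : functor C D) :
  nat_iso (comp_functor F (id_functor C)) F.
Proof.
have n x y (f : hom x y) : idm (F y) \oc fmap (comp_functor F (id_functor C)) f =
  fmap F f \oc idm (F x) by rewrite comp1m compm1.
exists (@NatTrans _ _ (comp_functor F (id_functor C)) F (fun x => idm (F x)) n) => x.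
by exists (idm (F x)); rewrite !comp1m.
Qed.

Lemma nat_iso_assoc (C D E E' : category) (H : functor E E') (G : functor D E)
    (F : functor C D) :
  nat_iso (comp_functor (comp_functor H G) F) (comp_functor H (comp_functor G F)).
Proof.
pose K := comp_functor H (comp_functor G F).
have n x y (f : hom x y) : idm (K y) \oc fmap (comp_functor (comp_functor H G) F) f =
  fmap K f \oc idm (K x) by rewrite comp1m compm1.
exists (@NatTrans _ _ (comp_functor (comp_functor H G) F) K (fun x => idm (K x)) n) => x.
by exists (idm (K x)); rewrite !comp1m.
Qed.

(* G1 is a left and G2 a right quasi-inverse, so G1 = G1 F G2 = G2. *)
Lemma equivalence_lr (C D : category) (F : functor C D) (G1 G2 : functor D C) :
  nat_iso (comp_functor G1 F) (id_functor C) ->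
  nat_iso (comp_functor F G2) (id_functor D) -> is_equivalence F.
Proof.
move=> l r; exists G2; split=> //.
have e : nat_iso G1 G2.
  apply: nat_iso_trans (nat_iso_idl G2).
  apply: nat_iso_trans (nat_iso_sym (nat_iso_idr G1)) _.
  apply: nat_iso_trans (nat_iso_compl G1 (nat_iso_sym r)) _.
  apply: nat_iso_trans (nat_iso_sym (nat_iso_assoc _ _ _)) _.
  exact: nat_iso_compr.
by apply: nat_iso_trans l; apply/nat_iso_compr/nat_iso_sym.
Qed.

(** * Natural maps between functors on a localization *)

Section LocalizationTheory.
Variables (C : category) (W : forall x y : C, hom x y -> Prop).

Lemma loc_iso (x y : C) (s : hom x y) : W s -> is_iso (fmap (loc_functor W) s).
Proof.
move=> Ws; exists (lclass (linv Ws)); split; rewrite /= lhom_compE; apply/lclass_eq.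
  exact: lrel_invl.
exact: lrel_invr.
Qed.

(** Induction on zigzags: composing the square of [s] with the inverse of [s] on both sides gives
    the square of that inverse, and squares paste along composites. Transformations of derived
    functors can therefore be checked on chain maps. *)
Lemma loc_nat (E : category) (F G : functor (localization W) E)
    (t : forall x : C, hom (F x) (G x)) :
  (forall (x y : C) (f : hom x y), t y \oc fmap F (fmap (loc_functor W) f) =
    fmap G (fmap (loc_functor W) f) \oc t x) ->
  forall (x y : localization W) (a : hom x y), t y \oc fmap F a = fmap G a \oc t x.
Proof.
move=> tn x y a; rewrite -[a]lclass_repr; elim: (lrepr a) => {x y a}.
- exact: tn.
- move=> x y s Ws; have := tn _ _ s.
  pose i : @hom (localization W) y x := lclass (linv Ws).
  have il : i \oc fmap (loc_functor W) s = idm (x : localization W).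
    by rewrite /= lhom_compE; apply/lclass_eq/lrel_invl.
  have ir : fmap (loc_functor W) s \oc i = idm (y : localization W).
    by rewrite /= lhom_compE; apply/lclass_eq/lrel_invr.
  move: (fmap (loc_functor W) s) il ir; rewrite -/i; move: i => i q il ir e.
  rewrite -[LHS]comp1m -fmap1 -il fmapM -compA [fmap G q \oc _]compA -e.
  by rewrite -[t y \oc _ \oc _]compA -fmapM ir fmap1 compm1.
move=> x y z u tu s ts.
have -> : lclass (lcomp u s) = (lclass u : @hom (localization W) _ _) \oc lclass s.
  by rewrite /= lhom_compE.
by rewrite !fmapM compA tu -compA ts compA.
Qed.

End LocalizationTheory.

Section ConeDerived.
Variables (A B : abelian_category) (U V : exact_functor A B).
Variable tau : exact_trans U V.

Definition scone_derived : functor (derived_category A) (derived_category B) :=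
  @localized_functor (complex_category A) (complex_category B)
    (@quasi_iso A) (@quasi_iso B) (scone_functor tau) (@scone_quasi_iso _ _ _ _ tau).

Lemma scone_derivedE X Y (f : chain_map X Y) :
  fmap scone_derived (fmap (derived_loc A) f) = fmap (derived_loc B) (scone_map tau f).
Proof. exact: lhom_mapE. Qed.

End ConeDerived.

Lemma derived_locM (A : abelian_category) (X Y Z : complex A)
    (g : chain_map Y Z) (f : chain_map X Y) :
  fmap (derived_loc A) (chain_comp g f) =
  fmap (derived_loc A) g \oc fmap (derived_loc A) f.
Proof. exact: (fmapM (derived_loc A)). Qed.

Lemma derived_shiftE (A : abelian_category) X Y (f : chain_map X Y) :
  fmap (derived_shift A) (fmap (derived_loc A) f) = fmap (derived_loc A) (shift_map f).
Proof. exact: lhom_mapE. Qed.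

Lemma derived_iso (A : abelian_category) (X Y : complex A) (f : chain_map X Y)
    (g : chain_map Y X) :
  chain_comp g f = chain_id X /\ chain_comp f g = chain_id Y ->
  is_iso (fmap (derived_loc A) f).
Proof.
by case=> gf fg; apply: iso_fmap; exists g.
Qed.

(** * Cone functors are triangulated *)

Section ConeTriangulated.
Variables (A B : abelian_category) (U V : exact_functor A B).
Variable tau : exact_trans U V.
Notation DS := (scone_derived tau).
Notation QA := (derived_loc A).
Notation QB := (derived_loc B).

Lemma scone_shift_derived_nat (x y : derived_category A) (a : hom x y) :
  fmap QB (scone_shift tau y) \oc fmap (comp_functor DS (derived_shift A)) a =
  fmap (comp_functor (derived_shift B) DS) a \oc fmap QB (scone_shift tau x).
Proof.
move: x y a.
apply: (@loc_nat _ _ _ (comp_functor DS (derived_shift A))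
  (comp_functor (derived_shift B) DS) (fun x => fmap QB (scone_shift tau x))) => X Y f.
have -> : fmap (comp_functor DS (derived_shift A)) (fmap QA f) =
    fmap QB (scone_map tau (shift_map f)).
  by rewrite -scone_derivedE -derived_shiftE.
have -> : fmap (comp_functor (derived_shift B) DS) (fmap QA f) =
    fmap QB (shift_map (scone_map tau f)).
  by rewrite -derived_shiftE -scone_derivedE.
have := congr1 (fun g => fmap QB g) (scone_shift_nat tau f).
by rewrite !derived_locM.
Qed.

Definition scone_shift_derived :
    nat_trans (comp_functor DS (derived_shift A)) (comp_functor (derived_shift B) DS) :=
  @NatTrans _ _ (comp_functor DS (derived_shift A)) (comp_functor (derived_shift B) DS)
    (fun x => fmap QB (scone_shift tau x)) scone_shift_derived_nat.

Lemma scone_shift_derived_iso x : is_iso (scone_shift_derived x).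
Proof. by have [g] := scone_shift_inv tau x; apply: derived_iso. Qed.

Lemma scone_derived_add (x y : derived_category A) (f g h : hom x y) :
  derived_is_sum f g h ->
  derived_is_sum (fmap DS f) (fmap DS g) (fmap DS h).
Proof.
case=> u [<- <- <-].
(* The canonical comparison S x (+) S x -> S (x (+) x). Following it by the image of [u] gives the
   map required on the direct sum. *)
pose pn n : phom (direct_sum (scone tau x) (scone tau x) n)
    (scone tau (direct_sum x x) n) :=
  scone_map tau (direct_sum_inl x x) n \op prl_ _ _ +
  scone_map tau (direct_sum_inr x x) n \op prr_ _ _.
have pE n w (a b : phom w (scone tau x n)) : pn n \op cpair a b =
    scone_map tau (direct_sum_inl x x) n \op a +
    scone_map tau (direct_sum_inr x x) n \op b.
  by rewrite pcompDl -!pcompA prl_cpair prr_cpair.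
have pd n : pn (succz n) \op cx_d (direct_sum _ _) n = cx_d (scone tau _) n \op pn n.
  apply: biprod_elt => w a b; rewrite -!(pcompA _ _ (cpair a b)) map_cpair !pE.
  by rewrite pcompDr !pcompA !cm_d.
pose p := ChainMap pd.
exists (fmap DS u \oc fmap QB p).
rewrite !fmapM !scone_derivedE -!compA -!fmapM.
split; congr (_ \oc fmap QB _); apply: chain_map_ext => n.
- by rewrite [LHS]pcompDl -!pcompA prl_inl prr_inl pcompm0 pcompm1 addr0.
- by rewrite [LHS]pcompDl -!pcompA prl_inr prr_inr pcompm0 pcompm1 add0r.
(* Additivity of [U] and [V] enters here, through [scone_mapD]. *)
have -> : diagonal x = chain_add (direct_sum_inl x x) (direct_sum_inr x x).
  exact: chain_map_ext.
rewrite scone_mapD [LHS]pcompDl !pcompDr -!pcompA.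
by rewrite prl_inl prl_inr prr_inl prr_inr !pcompm0 !pcompm1 addr0 add0r.
Qed.

(** The image of an isomorphism with the standard triangle of [f] is composed with [scone_cone] on
    the third vertex. *)
Lemma scone_derived_distinguished (x y z : derived_category A)
    (u : hom x y) (v : hom y z) (w : hom z (derived_shift A x)) :
  derived_distinguished u v w ->
  derived_distinguished (fmap DS u) (fmap DS v) (scone_shift_derived x \oc fmap DS w).
Proof.
move=> [K [L [f [a [b [c [[ai bi ci] [eu ev ew]]]]]]]].
exists (scone tau K), (scone tau L), (scone_map tau f), (fmap DS a), (fmap DS b).
exists (fmap QB (scone_cone tau f) \oc fmap DS c); split; first split.
- exact: iso_fmap.
- exact: iso_fmap.
- apply: iso_comp; last exact: iso_fmap.
  by have [g] := scone_cone_inv tau f; apply: derived_iso.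
split.
- by rewrite -(fmapM DS) eu (fmapM DS) scone_derivedE.
- rewrite -compA -(fmapM DS) ev (fmapM DS) scone_derivedE compA.
  by rewrite -derived_locM scone_cone_in.
pose s Z : hom (DS (derived_shift A Z)) (derived_shift B (DS Z)) := scone_shift_derived Z.
have sn : fmap (derived_shift B) (fmap DS a) \oc s x =
    s K \oc fmap DS (fmap (derived_shift A) a).
  exact/esym/(nt_nat scone_shift_derived a).
have sE : s K = fmap QB (scone_shift tau K) by [].
have e : fmap (derived_shift B) (fmap DS a) \oc (s x \oc fmap DS w) =
    s K \oc fmap DS (fmap (derived_shift A) a \oc w).
  by rewrite [LHS]compA sn -compA -(fmapM DS).
apply: (etrans e); rewrite ew (fmapM DS).
by rewrite scone_derivedE !compA sE -!derived_locM scone_cone_out.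
Qed.

Definition scone_triangulated :
    triangulated_functor (derived_triangulated A) (derived_triangulated B) :=
  @TriangulatedFunctor (derived_triangulated A) (derived_triangulated B) DS
    scone_derived_add scone_shift_derived scone_shift_derived_iso
    scone_derived_distinguished.

End ConeTriangulated.

(** * Functors and transformations induced on localizations *)

Section LocalizedFunctorTheory.
Variables (C D E : category).
Variables (W : forall x y : C, hom x y -> Prop).
Variables (W' : forall x y : D, hom x y -> Prop).
Variables (W'' : forall x y : E, hom x y -> Prop).

Lemma localized_nat_iso (F G : functor C D)
    (FW : forall x y (s : hom x y), W s -> W' (fmap F s))
    (GW : forall x y (s : hom x y), W s -> W' (fmap G s)) (t : nat_trans F G) :
  (forall x, W' (t x)) -> nat_iso (localized_functor FW) (localized_functor GW).
Proof.
move=> tW; pose LF := localized_functor FW; pose LG := localized_functor GW.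
have n := @loc_nat C W _ LF LG (fun x => fmap (loc_functor W') (t x)).
have {}n : forall (x y : localization W) (f : hom x y),
    fmap (loc_functor W') (t y) \oc fmap LF f = fmap LG f \oc fmap (loc_functor W') (t x).
  apply: n => x y f; rewrite /= !lhom_mapE /= !lhom_compE; apply/lclass_eq.
  apply: lrel_trans (lrel_mor _ _ _) => /=.
  by apply: lrel_trans (lrel_sym (lrel_mor _ _ _)) _; rewrite nt_nat; apply: lrel_refl.
exists (@NatTrans _ _ LF LG (fun x => fmap (loc_functor W') (t x)) n) => x.
exact: loc_iso.
Qed.

(** Both functors agree on objects and on the morphisms coming from [C], so identities are natural
    by [loc_nat]. *)
Lemma localized_comp (F : functor C D) (G : functor D E)
    (FW : forall x y (s : hom x y), W s -> W' (fmap F s))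
    (GW : forall x y (s : hom x y), W' s -> W'' (fmap G s))
    (GFW : forall x y (s : hom x y), W s -> W'' (fmap (comp_functor G F) s)) :
  nat_iso (comp_functor (localized_functor GW) (localized_functor FW))
    (localized_functor GFW).
Proof.
set H := comp_functor _ _; pose K := localized_functor GFW.
have n := @loc_nat C W _ H K (fun x => idm (K x)).
have {}n : forall (x y : localization W) (f : hom x y),
    idm (K y) \oc fmap H f = fmap K f \oc idm (K x).
  by apply: n => x y f; rewrite compm1 [LHS]comp1m /= !lhom_mapE.
exists (@NatTrans _ _ H K (fun x => idm (K x)) n) => x.
by exists (idm (K x)); rewrite comp1m.
Qed.

Lemma localized_id (IW : forall x y (s : hom x y), W s -> W (fmap (id_functor C) s)) :
  nat_iso (localized_functor IW) (id_functor (localization W)).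
Proof.
pose H := localized_functor IW; pose K := id_functor (localization W).
have n := @loc_nat C W _ H K (fun x => idm (K x)).
have {}n : forall (x y : localization W) (f : hom x y),
    idm (K y) \oc fmap H f = fmap K f \oc idm (K x).
  by apply: n => x y f; rewrite compm1 [LHS]comp1m /= lhom_mapE.
exists (@NatTrans _ _ H K (fun x => idm (K x)) n) => x.
by exists (idm (K x)); rewrite comp1m.
Qed.

End LocalizedFunctorTheory.

Section QuasiIsomorphisms.
Variable A : abelian_category.
Implicit Types X Y Z : complex A.

Lemma quasi_iso_comp X Y Z (g : chain_map Y Z) (f : chain_map X Y) :
  quasi_iso g -> quasi_iso f -> quasi_iso (chain_comp g f).
Proof.
move=> gq fq n.
have -> : cohomology_map (chain_comp g f) n = cohomology_map g n \op cohomology_map f n.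
  exact: homology_mapM.
exact: (@iso_comp A).
Qed.

Lemma iso_quasi_iso X Y (f : chain_map X Y) (g : chain_map Y X) :
  chain_comp g f = chain_id X -> chain_comp f g = chain_id Y -> quasi_iso f.
Proof.
have E Z Z' (h : chain_map Z Z') (k : chain_map Z' Z) n : chain_comp k h = chain_id Z ->
    cohomology_map k n \op cohomology_map h n = pid _.
  move=> kh; have e1 : pid (Z (succz n)) \op cx_d Z n = cx_d Z n \op pid _.
    by rewrite pcomp1m pcompm1.
  have e2 : pid _ \op cx_d Z (succz n) = cx_d Z (succz n) \op pid _.
    by rewrite pcomp1m pcompm1.
  rewrite -(homology_map1 (cx_dd Z n) e1 e2); apply/esym/homology_mapM.
  by rewrite -[RHS](congr1 (fun t : chain_map Z Z => t (succz n)) (esym kh)).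
by move=> gf fg n; exists (cohomology_map g n); split; apply: E.
Qed.

Lemma shift_reflects_quasi_iso X Y (f : chain_map X Y) :
  quasi_iso (shift_map f) -> quasi_iso f.
Proof.
move=> /quasi_isoP/acyclic_coneP ac; apply/quasi_isoP/acyclic_coneP => n.
have [m ->] := succz_surj n => w x y dx0 dy.
(* The shift negates the differentials but not [f], so a cycle (x, y) of [cone f] corresponds to the
   cycle (x, - y) for the shifted map. *)
have [||w' [e [x0 [y0 [ee /= ex ey]]]]] := ac m w x (- y).
- by rewrite /= pcompNm dx0 oppr0.
- by rewrite /= pcompNm pcompmN opprK.
exists w', e, (- x0), y0; split=> //.
  by rewrite pcompmN opprK -ex pcompNm opprK.
by apply: oppr_inj; rewrite -pcompNm -ey pcompmN pcompNm opprD opprK.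
Qed.

End QuasiIsomorphisms.

(** * Invertibility of the shift *)

Section Unshift.
Variable A : abelian_category.
Implicit Types X Y Z : complex A.

(** For a variable n, the degrees n - 1 + 1 and n are equal but not convertible. The inverse shift
    therefore needs transport between terms of a complex, unlike the shift itself. *)
Definition cx_cast X m n (e : m = n) : phom (X m) (X n) :=
  match e in _ = k return phom (X m) (X k) with erefl => pid (X m) end.

Lemma cx_cast_id X m (e : m = m) : cx_cast X e = pid (X m).
Proof. by rewrite (eq_irrelevance e erefl). Qed.

Lemma cx_castM X m n k (e : m = n) (e' : n = k) (e'' : m = k) :
  cx_cast X e' \op cx_cast X e = cx_cast X e''.
Proof. by case: k / e' e''; case: n / e => e''; rewrite !cx_cast_id pcomp1m. Qed.

Lemma cx_cast_d X m n (e : m = n) (e' : succz m = succz n) :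
  cx_d X n \op cx_cast X e = cx_cast X e' \op cx_d X m.
Proof. by case: n / e e' => e'; rewrite !cx_cast_id pcomp1m pcompm1. Qed.

Lemma cm_cast X Y (f : chain_map X Y) m n (e : m = n) :
  f n \op cx_cast X e = cx_cast Y e \op f m.
Proof. by case: n / e; rewrite pcomp1m pcompm1. Qed.

Definition predz (n : int) : int := n - 1.

Lemma succzK : cancel succz predz. Proof. by move=> n; rewrite /predz addrK. Qed.
Lemma predzK : cancel predz succz. Proof. by move=> n; rewrite /succz subrK. Qed.

Fact succ_predz n : succz (predz n) = predz (succz n).
Proof. by rewrite succzK predzK. Qed.

Definition unshift_complex X : complex A.
Proof.
exists (fun n => X (predz n))
       (fun n => cx_cast X (succ_predz n) \op - cx_d X (predz n)) => n.
rewrite !pcompmN pcompNm opprK -pcompA [cx_d _ _ \op _]pcompA.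
by rewrite (cx_cast_d _ _ (congr1 succz (succ_predz n))) -pcompA cx_dd !pcompm0.
Defined.

Definition unshift_map X Y (f : chain_map X Y) :
  chain_map (unshift_complex X) (unshift_complex Y).
Proof.
exists (fun n => f (predz n)) => n /=.
by rewrite pcompA cm_cast -!pcompA pcompmN pcompNm cm_d.
Defined.

Lemma unshift_map1 X : unshift_map (chain_id X) = chain_id (unshift_complex X).
Proof. exact: chain_map_ext. Qed.

Lemma unshift_mapM X Y Z (g : chain_map Y Z) (f : chain_map X Y) :
  unshift_map (chain_comp g f) = chain_comp (unshift_map g) (unshift_map f).
Proof. exact: chain_map_ext. Qed.

Definition unshift_functor : functor (complex_category A) (complex_category A) :=
  @Functor (complex_category A) (complex_category A)
    unshift_complex unshift_map unshift_map1 unshift_mapM.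

Definition shift_unshift X : chain_map (shift_complex (unshift_complex X)) X.
Proof.
exists (fun n => cx_cast X (succzK n)) => n /=.
rewrite !pcompmN opprK pcompA (cx_castM _ _ _ (congr1 succz (succzK n))).
by rewrite (cx_cast_d _ _ (congr1 succz (succzK n))).
Defined.

Definition unshift_shift X : chain_map (unshift_complex (shift_complex X)) X.
Proof.
exists (fun n => cx_cast X (predzK n)) => n /=.
have -> : cx_cast (shift_complex X) (succ_predz n) =
    cx_cast X (congr1 succz (succ_predz n)).
  by case: (predz (succz n)) / (succ_predz n).
rewrite opprK pcompA (cx_castM _ _ _ (congr1 succz (predzK n))).
by rewrite -(cx_cast_d _ (predzK n)).
Defined.

Lemma degreewise_iso X Y (f : chain_map X Y)
    (h : forall n, exists g : phom (Y n) (X n), g \op f n = pid _ /\ f n \op g = pid _) :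
  exists g : chain_map Y X, chain_comp g f = chain_id X /\ chain_comp f g = chain_id Y.
Proof.
pose g n := projT1 (cid (h n)).
by apply: (chain_inv (g := g)) => n; case: (projT2 (cid (h n))).
Qed.

Lemma shift_unshift_inv X : exists g : chain_map X (shift_complex (unshift_complex X)),
  chain_comp g (shift_unshift X) = chain_id _ /\
  chain_comp (shift_unshift X) g = chain_id X.
Proof.
apply: degreewise_iso => n; exists (cx_cast X (esym (succzK n))).
by split; rewrite /= (cx_castM _ _ _ erefl).
Qed.

Lemma unshift_shift_inv X : exists g : chain_map X (unshift_complex (shift_complex X)),
  chain_comp g (unshift_shift X) = chain_id _ /\
  chain_comp (unshift_shift X) g = chain_id X.
Proof.
apply: degreewise_iso => n; exists (cx_cast X (esym (predzK n))).
by split; rewrite /= (cx_castM _ _ _ erefl).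
Qed.

Lemma shift_unshift_nat X Y (f : chain_map X Y) :
  chain_comp (shift_unshift Y) (shift_map (unshift_map f)) =
  chain_comp f (shift_unshift X).
Proof. by apply: chain_map_ext => n /=; rewrite cm_cast. Qed.

Lemma unshift_shift_nat X Y (f : chain_map X Y) :
  chain_comp (unshift_shift Y) (unshift_map (shift_map f)) =
  chain_comp f (unshift_shift X).
Proof. by apply: chain_map_ext => n /=; rewrite cm_cast. Qed.

(** The shift reflects quasi-isomorphisms, and the shift of [unshift_map f] is conjugate to [f]
    through [shift_unshift]. *)
Lemma unshift_quasi_iso X Y (f : chain_map X Y) :
  quasi_iso f -> quasi_iso (unshift_map f).
Proof.
move=> fq; apply: shift_reflects_quasi_iso.
have [g [gy yg]] := shift_unshift_inv Y; have [h [hx xh]] := shift_unshift_inv X.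
have -> : shift_map (unshift_map f) = chain_comp g (chain_comp f (shift_unshift X)).
  by rewrite -shift_unshift_nat chain_compA gy chain_comp1m.
apply: quasi_iso_comp; first exact: iso_quasi_iso yg gy.
by apply: quasi_iso_comp => //; apply: iso_quasi_iso hx xh.
Qed.

End Unshift.

(** * Mutually inverse cones *)

Definition short_exact (A : abelian_category) (x y z : A)
    (f : phom x y) (g : phom y z) : Prop :=
  [/\ is_mono f, g \op f = 0, exact f g & is_epi g].

(* The conditions on (x, y, z) say that it is a cycle of the total complex. *)
Lemma short_exact_total (A : abelian_category) (X Y Z : complex A)
    (f : chain_map X Y) (g : chain_map Y Z) :
  (forall n, short_exact (f n) (g n)) ->
  forall n w (x : phom w (X (succz (succz n)))) (y : phom w (Y (succz n)))
    (z : phom w (Z n)),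
  cx_d X (succz (succz n)) \op x = 0 ->
  f (succz (succz n)) \op x = cx_d Y (succz n) \op y ->
  g (succz n) \op y + cx_d Z n \op z = 0 ->
  exists (w' : A) (e : phom w' w) (x0 : phom w' (X (succz n))) (y0 : phom w' (Y n)),
    [/\ is_epi e, cx_d X (succz n) \op x0 = x \op e,
        f (succz n) \op x0 - cx_d Y n \op y0 = y \op e & g n \op y0 = z \op e].
Proof.
move=> fg n w x y z dx0 fx gy.
(* A staircase chase: lift z to y1 along [g]; then y + d y1 is killed by [g] and comes from some x2.
   That d x2 is x follows since [f] is mono. *)
have [_ _ _ gn] := fg n; have [w1 [e1 [y1 [ee1 ey1]]]] := epi_lift z gn.
have [_ _ ex _] := fg (succz n).
have [|w2 [e2 [x2 [ee2 ex2]]]] := ex w1 (y \op e1 + cx_d Y n \op y1).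
  rewrite pcompDr [_ \op (cx_d Y n \op y1)]pcompA cm_d -[_ \op y1]pcompA ey1.
  by rewrite !pcompA -pcompDl gy pcomp0m.
exists w2, (e1 \op e2), x2, (y1 \op e2); split.
- exact: epi_comp.
- have [fm _ _ _] := fg (succz (succz n)); apply: fm.
  rewrite pcompA cm_d -pcompA -ex2 pcompA pcompDr [_ \op (_ \op y1)]pcompA cx_dd.
  by rewrite pcomp0m addr0 !pcompA fx.
- by rewrite -ex2 pcompDl -!pcompA addrK.
by rewrite pcompA ey1 pcompA.
Qed.

(** * The cone of a cone as the total complex of a square *)

Section ComposedCones.
Variables (A B C : abelian_category).
Variables (U V : exact_functor A B) (tau : exact_trans U V).
Variables (U' V' : exact_functor B C) (tau' : exact_trans U' V').
Variable X : complex A.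
Notation SS := (scone tau' (scone tau X)).

(** Coordinates in the four corners U'U, U'V, V'U and V'V. The functors need not preserve the chosen
    biproducts, so coordinates are inserted through the images of [inl_] and [inr_]. *)
Definition quad n w (l : phom w (U' (U (X (succz (succz n))))))
    (m : phom w (U' (V (X (succz n))))) (f : phom w (V' (U (X (succz n)))))
    (r : phom w (V' (V (X n)))) : phom w (SS n) :=
  cpair (emap U' (inl_ _ _) \op l + emap U' (inr_ _ _) \op m)
        (emap V' (inl_ _ _) \op f + emap V' (inr_ _ _) \op r).

Lemma quad_eta n w (z : phom w (SS n)) : exists l m f r, z = quad l m f r.
Proof.
rewrite [z]cpair_eta; set a := prl_ _ _ \op z; set b := prr_ _ _ \op z.
by rewrite [a]emap_biprod [b]emap_biprod; do 4 eexists.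
Qed.

Lemma quad_inj n w l m f r l' m' f' r' :
  quad l m f r = quad l' m' f' r' :> phom w (SS n) ->
  [/\ l = l', m = m', f = f' & r = r'].
Proof.
move=> /cpair_inj[e1 e2].
have E (D E : abelian_category) (F : exact_functor D E) (x y : D) v
    (a a' : phom v (F x)) (b b' : phom v (F y)) :
    emap F (inl_ x y) \op a + emap F (inr_ _ _) \op b =
    emap F (inl_ _ _) \op a' + emap F (inr_ _ _) \op b' -> a = a' /\ b = b'.
  move=> e; split.
    have := congr1 (fun t => emap F (prl_ _ _) \op t) e.
    rewrite !pcompDr !emap_app !prl_inl !prl_inr !emap0 !emap1.
    by rewrite !pcomp1m !pcomp0m !addr0.
  have := congr1 (fun t => emap F (prr_ _ _) \op t) e.
  rewrite !pcompDr !emap_app !prr_inl !prr_inr !emap0 !emap1.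
  by rewrite !pcomp1m !pcomp0m !add0r.
by have [-> ->] := E _ _ _ _ _ _ _ _ _ _ e1; have [-> ->] := E _ _ _ _ _ _ _ _ _ _ e2.
Qed.

Lemma quad_comp n w l m f r v (e : phom v w) :
  (quad l m f r : phom w (SS n)) \op e = quad (l \op e) (m \op e) (f \op e) (r \op e).
Proof. by rewrite cpair_comp !pcompDl -!pcompA. Qed.

Lemma quadD n w l m f r l' m' f' r' :
  quad l m f r + quad l' m' f' r' =
  quad (l + l') (m + m') (f + f') (r + r') :> phom w (SS n).
Proof. by rewrite /quad cpairD !pcompDr; congr cpair; rewrite addrACA. Qed.

Lemma quadN n w l m f r :
  - quad l m f r = quad (- l) (- m) (- f) (- r) :> phom w (SS n).
Proof. by rewrite /quad cpairN !pcompmN !opprD. Qed.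

Lemma quad0 n w : quad 0 0 0 0 = 0 :> phom w (SS n).
Proof. by rewrite /quad !pcompm0 !addr0 cpair0. Qed.

(** Each cone negates the differential of its source: the signs cancel on U'U and survive on the two
    middle corners. The minus at [tau] makes the square anticommute. *)
Lemma quad_d n w l m f r :
  cx_d SS n \op (quad l m f r : phom w _) = quad
    (emap U' (emap U (cx_d X _)) \op l)
    (- (emap U' (tau _) \op l + emap U' (emap V (cx_d X _)) \op m))
    (tau' _ \op l - emap V' (emap U (cx_d X _)) \op f)
    (tau' _ \op m + (emap V' (tau _) \op f + emap V' (emap V (cx_d X _)) \op r)).
Proof.
have dl k : cx_d (scone tau X) k \op inl_ _ _ =
    - (inl_ _ _ \op emap U (cx_d X (succz k))) + inr_ _ _ \op tau (X (succz k)).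
  rewrite -[inl_ _ _]pcompm1 inl_cpair scone_d_cpair !pcompm0 addr0 !pcompm1.
  by rewrite /cpair pcompmN.
have dr k : cx_d (scone tau X) k \op inr_ _ _ = inr_ _ _ \op emap V (cx_d X k).
  rewrite -[inr_ _ _]pcompm1 inr_cpair scone_d_cpair !pcompm0 oppr0 add0r !pcompm1.
  by rewrite inr_cpair.
rewrite /quad scone_d_cpair; congr cpair.
  rewrite !pcompDr !emap_app dl dr emapD emapN !emapM pcompDl pcompNm -!pcompA.
  by rewrite !pcompmN !pcompDr !opprD opprK -addrA.
rewrite !pcompDr !emap_app dl dr emapD emapN !emapM pcompDl pcompNm.
rewrite -!pcompA !et_app_nat !pcompmN.
by rewrite -!addrA; congr (_ + _); rewrite addrCA; congr (_ + _).
Qed.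

End ComposedCones.

Section UnshiftDerived.
Variable A : abelian_category.

Definition derived_unshift : functor (derived_category A) (derived_category A) :=
  @localized_functor (complex_category A) (complex_category A)
    (@quasi_iso A) (@quasi_iso A) (unshift_functor A) (@unshift_quasi_iso A).

Let quasi_iso_id (X Y : complex_category A) (s : hom X Y) :
  quasi_iso s -> quasi_iso (fmap (id_functor _) s).
Proof. by []. Qed.

Lemma unshift_shift_derived :
  nat_iso (comp_functor derived_unshift (derived_shift A)) (id_functor _).
Proof.
pose F := comp_functor (unshift_functor A) (shift_functor A).
pose I := id_functor (complex_category A).
have Fq (X Y : complex_category A) (s : hom X Y) : quasi_iso s -> quasi_iso (fmap F s).
  by move=> /shift_quasi_iso/unshift_quasi_iso.
apply: nat_iso_trans (localized_comp _ _ Fq) _.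
apply: nat_iso_trans (localized_id quasi_iso_id).
have n (X Y : complex_category A) (f : hom X Y) :
    (unshift_shift Y : hom (F Y) (I Y)) \oc fmap F f =
    fmap I f \oc (unshift_shift X : hom (F X) (I X)).
  exact: unshift_shift_nat.
apply: (localized_nat_iso _ _ (t := @NatTrans _ _ F I (@unshift_shift A) n)) => X.
by have [g [gf fg]] := unshift_shift_inv X; apply: iso_quasi_iso gf fg.
Qed.

Lemma shift_unshift_derived :
  nat_iso (comp_functor (derived_shift A) derived_unshift) (id_functor _).
Proof.
pose F := comp_functor (shift_functor A) (unshift_functor A).
pose I := id_functor (complex_category A).
have Fq (X Y : complex_category A) (s : hom X Y) : quasi_iso s -> quasi_iso (fmap F s).
  by move=> /unshift_quasi_iso/shift_quasi_iso.
apply: nat_iso_trans (localized_comp _ _ Fq) _.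
apply: nat_iso_trans (localized_id quasi_iso_id).
have n (X Y : complex_category A) (f : hom X Y) :
    (shift_unshift Y : hom (F Y) (I Y)) \oc fmap F f =
    fmap I f \oc (shift_unshift X : hom (F X) (I X)).
  exact: shift_unshift_nat.
apply: (localized_nat_iso _ _ (t := @NatTrans _ _ F I (@shift_unshift A) n)) => X.
by have [g [gf fg]] := shift_unshift_inv X; apply: iso_quasi_iso gf fg.
Qed.

End UnshiftDerived.

(** * Two cone functors inverse to each other up to shift *)

Section Equivalence.
Variables (A B : abelian_category).
Variables (U V : exact_functor A B) (tau : exact_trans U V).
Variables (U' V' : exact_functor B A) (tau' : exact_trans U' V').
Hypothesis UU0 : forall x, pid (U' (U x)) = 0.
Hypothesis VV0 : forall y, pid (V (V' y)) = 0.

(* Since U'U = 0, T (S x) is the total complex of U'V x (+) V'U x -> V'V x, which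
   is a resolution of x by unit_exact; dually for S (T y), as VV' = 0. *)
Variables (alpha : forall x, phom x (U' (V x))) (beta : forall x, phom x (V' (U x))).
Hypothesis alpha_nat : forall x y (f : phom x y),
  alpha y \op f = emap U' (emap V f) \op alpha x.
Hypothesis beta_nat : forall x y (f : phom x y),
  beta y \op f = emap V' (emap U f) \op beta x.
Hypothesis unit_exact : forall x, short_exact (cpair (alpha x) (beta x))
  (tau' (V x) \op prl_ _ _ + emap V' (tau x) \op prr_ _ _).

Variables (alpha' : forall y, phom (V (U' y)) y) (beta' : forall y, phom (U (V' y)) y).
Hypothesis alpha'_nat : forall x y (f : phom x y),
  f \op alpha' x = alpha' y \op emap V (emap U' f).
Hypothesis beta'_nat : forall x y (f : phom x y),
  f \op beta' x = beta' y \op emap U (emap V' f).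
Hypothesis counit_exact : forall y, short_exact (cpair (tau (U' y)) (- emap U (tau' y)))
  (alpha' y \op prl_ _ _ + beta' y \op prr_ _ _).

Notation S := (scone tau).
Notation T := (scone tau').

Lemma quad_eta0 (X : complex A) n w (z : phom w (T (S X) n)) :
  exists m f r, z = quad tau tau' 0 m f r.
Proof.
have [l [m [f [r ->]]]] := quad_eta z; exists m, f, r.
by rewrite (to_zero l (UU0 _)).
Qed.

Lemma unit0 x : tau' (V x) \op alpha x + emap V' (tau x) \op beta x = 0.
Proof.
have [_ + _ _] := unit_exact x.
by rewrite pcompDl -!pcompA prl_cpair prr_cpair.
Qed.

(** In degree n the middle corners involve X^{n+1}, hence the shift on the source; its negated
    differential matches the signs of [quad_d] on these corners. *)
Definition unit_app (X : complex A) n : phom (shift_complex X n) (T (S X) n) :=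
  quad tau tau' 0 (alpha (X (succz n))) (beta (X (succz n))) 0.

Lemma unit_appE (X : complex A) n w (a : phom w (X (succz n))) :
  unit_app X n \op a = quad tau tau' 0 (alpha _ \op a) (beta _ \op a) 0.
Proof. by rewrite quad_comp !pcomp0m. Qed.

Definition unit_map (X : complex A) : chain_map (shift_complex X) (T (S X)).
Proof.
exists (unit_app X) => n.
rewrite unit_appE /unit_app quad_d; congr quad.
- by rewrite pcompm0.
- by rewrite pcompm0 add0r pcompmN alpha_nat.
- by rewrite pcompm0 add0r pcompmN beta_nat.
by rewrite pcompm0 addr0 unit0.
Defined.

Lemma unit_map_nat (X Y : complex A) (f : chain_map X Y) :
  chain_comp (unit_map Y) (shift_map f) =
  chain_comp (scone_map tau' (scone_map tau f)) (unit_map X).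
Proof.
apply: chain_map_ext => n /=.
rewrite unit_appE alpha_nat beta_nat /unit_app /quad map_cpair.
rewrite !pcompDr !emap_app !map_inl !map_inr !pcompm0 !add0r !addr0.
by rewrite !emapM.
Qed.

(** Together with [unit_out] this is a short exact sequence of complexes by [unit_exact]. As U'U =
    0, its total complex is the cone of [unit_map], up to signs and a shift. *)
Definition unit_in (X : complex A) : chain_map X
  (direct_sum (emap_complex U' (emap_complex V X)) (emap_complex V' (emap_complex U X))).
Proof.
exists (fun n => cpair (alpha (X n)) (beta (X n))) => n.
by rewrite cpair_comp map_cpair alpha_nat beta_nat.
Defined.

Definition unit_out (X : complex A) : chain_map
  (direct_sum (emap_complex U' (emap_complex V X)) (emap_complex V' (emap_complex U X)))
  (emap_complex V' (emap_complex V X)).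
Proof.
exists (fun n => tau' (V (X n)) \op prl_ _ _ + emap V' (tau (X n)) \op prr_ _ _) => n.
apply: biprod_elt => w a b.
rewrite -!(pcompA _ _ (cpair a b)) map_cpair !pcompDl -!pcompA !prl_cpair !prr_cpair.
rewrite pcompDr; congr (_ + _); first exact: et_app_nat.
by rewrite !emap_app et_nat.
Defined.

Lemma unit_quasi_iso X : quasi_iso (unit_map X).
Proof.
apply/quasi_isoP/acyclic_coneP => n w x z dx.
have [m [f [r ->]]] := quad_eta0 z.
rewrite unit_appE quad_d quadD -(quad0 tau tau' X) => /quad_inj[_].
rewrite !pcompm0 !add0r => em ef er.
have [|||w' [e [x0 [y0 [ee ex ey er']]]]] :=
    short_exact_total (f := unit_in X) (g := unit_out X)
    (fun k => unit_exact (X k)) (n := succz n) (x := x) (y := cpair m f) (z := r).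
- by apply/eqP; rewrite -oppr_eq0 -pcompNm; apply/eqP.
- rewrite map_cpair cpair_comp; congr cpair; apply/eqP; rewrite -subr_eq0.
    exact/eqP.
  exact/eqP.
- by rewrite pcompDl -!pcompA prl_cpair prr_cpair -addrA.
move: ey er'; rewrite [y0]cpair_eta; move: (prl_ _ _ \op y0) (prr_ _ _ \op y0) => m1 f1.
rewrite map_cpair !cpair_comp cpairN cpairD => /cpair_inj[em1 ef1].
rewrite pcompDl -!pcompA prl_cpair prr_cpair => er1.
(* The last coordinate can be 0, since by [er1] the pair (m1, f1) already maps onto r. *)
exists w', e, x0, (quad tau tau' 0 m1 f1 0); split=> //.
  by rewrite pcompNm opprK.
rewrite unit_appE quad_d quadD quad_comp; congr quad.
- by rewrite pcompm0 addr0 pcomp0m.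
- by rewrite pcompm0 add0r.
- by rewrite pcompm0 add0r.
by rewrite pcompm0 addr0 add0r.
Qed.

Lemma quad_eta0' (Y : complex B) n w (z : phom w (S (T Y) n)) :
  exists l m f, z = quad tau' tau l m f 0.
Proof.
have [l [m [f [r ->]]]] := quad_eta z; exists l, m, f.
by rewrite (to_zero r (VV0 _)).
Qed.

Lemma counit0 y : alpha' y \op tau (U' y) = beta' y \op emap U (tau' y).
Proof.
have [_ + _ _] := counit_exact y.
rewrite pcompDl -!pcompA prl_cpair prr_cpair pcompmN => /eqP.
by rewrite subr_eq0 => /eqP.
Qed.

(** The formula reads off the two middle coordinates, those in U V' and V U', both in degree n + 1
    of [Y]. *)
Definition counit_app (Y : complex B) n : phom (S (T Y) n) (shift_complex Y n) :=
  beta' (Y (succz n)) \op (emap U (prr_ _ _) \op prl_ _ _) +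
  alpha' (Y (succz n)) \op (emap V (prl_ _ _) \op prr_ _ _).

Lemma counit_appE (Y : complex B) n w l m f r :
  counit_app Y n \op (quad tau' tau l m f r : phom w _) =
  beta' _ \op m + alpha' _ \op f.
Proof.
rewrite pcompDl -!pcompA prl_cpair prr_cpair !pcompDr !emap_app.
rewrite prr_inl prr_inr prl_inl prl_inr !emap0 !emap1 !pcomp0m !pcomp1m.
by rewrite pcompm0 add0r pcompm0 addr0.
Qed.

Definition counit_map (Y : complex B) : chain_map (S (T Y)) (shift_complex Y).
Proof.
exists (counit_app Y) => n.
rewrite -[LHS]pcompm1 -[RHS]pcompm1; have [l [m [f e]]] := quad_eta0' (pid (S (T Y) n)).
rewrite e -!pcompA quad_d !counit_appE.
have -> : cx_d (shift_complex Y) n = - cx_d Y (succz n) by [].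
rewrite pcompNm !pcompDr !pcompmN !pcompDr !pcompA alpha'_nat beta'_nat counit0.
by rewrite opprD addrA [_ - _ + _]addrAC addNr sub0r opprD.
Defined.

Lemma counit_map_nat (X Y : complex B) (f : chain_map X Y) :
  chain_comp (counit_map Y) (scone_map tau (scone_map tau' f)) =
  chain_comp (shift_map f) (counit_map X).
Proof.
apply: chain_map_ext => n; apply: biprod_elt => w a b /=.
rewrite -!pcompA map_cpair !pcompDl -!pcompA !prl_cpair !prr_cpair !emap_app.
rewrite prr_map prl_map !emapM -!pcompA pcompDr.
by congr (_ + _); rewrite !pcompA ?alpha'_nat ?beta'_nat.
Qed.

Definition counit_in (Y : complex B) : chain_map
  (emap_complex U (emap_complex U' Y))
  (direct_sum (emap_complex V (emap_complex U' Y)) (emap_complex U (emap_complex V' Y))).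
Proof.
exists (fun n => cpair (tau (U' (Y n))) (- emap U (tau' (Y n)))) => n.
rewrite cpair_comp map_cpair; congr cpair; first exact: et_nat.
by rewrite pcompNm pcompmN -!emapM et_nat.
Defined.

Definition counit_out (Y : complex B) : chain_map
  (direct_sum (emap_complex V (emap_complex U' Y)) (emap_complex U (emap_complex V' Y)))
  Y.
Proof.
exists (fun n => alpha' (Y n) \op prl_ _ _ + beta' (Y n) \op prr_ _ _) => n.
apply: biprod_elt => w a b.
rewrite -!(pcompA _ _ (cpair a b)) map_cpair !pcompDl -!pcompA !prl_cpair !prr_cpair.
by rewrite pcompDr !pcompA alpha'_nat beta'_nat.
Defined.

Lemma counit_quasi_iso Y : quasi_iso (counit_map Y).
Proof.
apply/quasi_isoP/acyclic_coneP => n w x z.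
have [l [m [f ->]]] := quad_eta0' x.
rewrite quad_d -(quad0 tau' tau Y) => /quad_inj[el em ef _].
rewrite [counit_map Y _ \op _]counit_appE pcompNm => ez.
(* The middle coordinates are swapped because [counit_exact] lists V U' before U V'. The sign of z
   comes from the negated differential of the shifted complex. *)
have [|||w' [e [x0 [y0 [ee ex]]]]] :=
    short_exact_total (f := counit_in Y) (g := counit_out Y)
    (fun k => counit_exact (Y k)) (n := succz (succz n))
    (x := l) (y := cpair f m) (z := - z).
- exact: el.
- rewrite map_cpair cpair_comp; congr cpair.
    by apply/eqP; rewrite -subr_eq0; apply/eqP.
  by rewrite pcompNm; apply/eqP; rewrite eq_sym -addr_eq0 addrC -oppr_eq0; apply/eqP.
- rewrite pcompDl -!pcompA prl_cpair prr_cpair pcompmN.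
  by rewrite [X in X - _]addrC.
rewrite [y0]cpair_eta; move: (prl_ _ _ \op y0) (prr_ _ _ \op y0) => f1 m1.
rewrite map_cpair !cpair_comp cpairN cpairD => /cpair_inj[ef1 em1].
rewrite pcompDl -!pcompA prl_cpair prr_cpair => ez1.
(* The signs undo that of the cone differential. The component in the target can be 0, since by
   [ez1] the pair (f1, m1) already maps onto - z. *)
exists w', e, (quad tau' tau (- x0) (- m1) (- f1) 0), 0; split=> //.
  rewrite quad_d quadN quad_comp; congr quad.
  - by rewrite pcompmN opprK.
  - by rewrite opprK -em1 !pcompmN pcompNm.
  - by rewrite -ef1 !pcompmN opprK opprD opprK.
  by rewrite (to_zero (_ \op e) (VV0 _)) (to_zero (- _) (VV0 _)).
rewrite [counit_map Y _ \op _]counit_appE pcompm0 addr0 !pcompmN -opprD addrC.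
by rewrite ez1 pcompNm opprK.
Qed.

Notation DS := (scone_derived tau).
Notation DT := (scone_derived tau').

Lemma unit_derived : nat_iso (comp_functor DT DS) (derived_shift A).
Proof.
pose F := comp_functor (scone_functor tau') (scone_functor tau).
have Fq (X Y : complex_category A) (s : hom X Y) : quasi_iso s -> quasi_iso (fmap F s).
  by move=> /(@scone_quasi_iso _ _ _ _ tau)/(@scone_quasi_iso _ _ _ _ tau').
apply: nat_iso_trans (localized_comp _ _ Fq) (nat_iso_sym _).
have n (X Y : complex_category A) (f : hom X Y) :
    (unit_map Y : hom (shift_functor A Y) (F Y)) \oc fmap (shift_functor A) f =
    fmap F f \oc (unit_map X : hom (shift_functor A X) (F X)).
  exact: unit_map_nat.
apply: (localized_nat_iso _ _ (t := @NatTrans _ _ (shift_functor A) F unit_map n)).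
exact: unit_quasi_iso.
Qed.

Lemma counit_derived : nat_iso (comp_functor DS DT) (derived_shift B).
Proof.
pose F := comp_functor (scone_functor tau) (scone_functor tau').
have Fq (X Y : complex_category B) (s : hom X Y) : quasi_iso s -> quasi_iso (fmap F s).
  by move=> /(@scone_quasi_iso _ _ _ _ tau')/(@scone_quasi_iso _ _ _ _ tau).
apply: nat_iso_trans (localized_comp _ _ Fq) _.
have n (X Y : complex_category B) (f : hom X Y) :
    (counit_map Y : hom (F Y) (shift_functor B Y)) \oc fmap F f =
    fmap (shift_functor B) f \oc (counit_map X : hom (F X) (shift_functor B X)).
  exact: counit_map_nat.
apply: (localized_nat_iso _ _ (t := @NatTrans _ _ F (shift_functor B) counit_map n)).
exact: counit_quasi_iso.
Qed.

(** A left inverse is [DT] followed by the inverse shift, a right inverse is [DT] preceded by it;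
    [equivalence_lr] spares comparing the two directly. *)
Lemma scone_equivalence : is_equivalence DS.
Proof.
apply: (@equivalence_lr _ _ _ (comp_functor (derived_unshift A) DT)
  (comp_functor DT (derived_unshift B))).
  apply: nat_iso_trans (nat_iso_assoc _ _ _) _.
  apply: nat_iso_trans (nat_iso_compl _ unit_derived) _.
  exact: unshift_shift_derived.
apply: nat_iso_trans (nat_iso_sym (nat_iso_assoc _ _ _)) _.
apply: nat_iso_trans (nat_iso_compr _ counit_derived) _.
exact: shift_unshift_derived.
Qed.

End Equivalence.

(** * Diagrams on the two ordinal sums *)

Lemma short_exact_split (A : abelian_category) (x y z : A) (f : phom x y)
    (g : phom y z) (r : phom y x) (s : phom z y) :
  g \op f = 0 -> r \op f = pid x -> g \op s = pid z ->
  f \op r + s \op g = pid y -> short_exact f g.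
Proof.
move=> gf rf gs frsg; split=> //.
- by move=> w u v uv; rewrite -[u]pcomp1m -[v]pcomp1m -rf -!pcompA uv.
- move=> w a ga0; exists w, (pid w), (r \op a); split; first exact: epi_pid.
  by rewrite pcompm1 -[LHS]pcomp1m -frsg pcompDl -!pcompA ga0 pcompm0 addr0.
by move=> w u v uv; rewrite -[u]pcompm1 -[v]pcompm1 -gs !pcompA uv.
Qed.

(** * Exactness of diagrams, point by point *)

Section PointwiseExactness.
Variables (d : Order.disp_t) (P : porderType d) (A : abelian_category).
Notation AP := (functor_category P A).
Implicit Types F G H : AP.

Definition at_pt F G (s : phom F G) (p : P) : phom (F p : A) (G p) := dm s p.

Lemma at_pt_ext F G (s t : phom F G) : (forall p, at_pt s p = at_pt t p) -> s = t.
Proof. exact: diagram_map_ext. Qed.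

Lemma fepiP F G (s : phom F G) : is_epi s <-> forall p, is_epi (at_pt s p).
Proof.
split=> [/epi_coker0 s0 p|se].
  by apply/epi_coker0; exact: (congr1 (fun t : phom _ _ => at_pt t p) s0).
by apply/epi_coker0/at_pt_ext => p; apply: (epi_coker0 (at_pt s p)).1.
Qed.

(** Kernels of diagrams are pointwise, so the map into the cycles evaluates at [p] to the
    corresponding map there; [exactP] and [fepiP] conclude. *)
Lemma fexactP F G H (s : phom F G) (t : phom G H) : t \op s = 0 ->
  exact s t <-> forall p, exact (at_pt s p) (at_pt t p).
Proof.
move=> ts0; have ts0p p : at_pt t p \op at_pt s p = 0.
  exact: (congr1 (fun u : phom _ _ => at_pt u p) ts0).
have lE p : at_pt (ker_lift ts0) p = ker_lift (ts0p p).
  apply: kerm_mono; rewrite ker_liftK.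
  exact: (congr1 (fun u : phom _ _ => at_pt u p) (ker_liftK ts0)).
split=> [/(exactP ts0)/fepiP le p|ep].
  by apply/(exactP (ts0p p)); rewrite -lE.
by apply/(exactP ts0)/fepiP => p; rewrite lE; apply/exactP.
Qed.

Lemma fshort_exact F G H (s : phom F G) (t : phom G H) :
  (forall p, short_exact (at_pt s p) (at_pt t p)) -> short_exact s t.
Proof.
move=> st; have ts0 : t \op s = 0 by apply: at_pt_ext => p; case: (st p).
split=> //; last by apply/fepiP => p; case: (st p).
- move=> w g h gh; apply: at_pt_ext => p; have [sm _ _ _] := st p.
  by apply: sm; exact: (congr1 (fun u : phom _ _ => at_pt u p) gh).
- by apply/fexactP => // p; case: (st p).
Qed.

End PointwiseExactness.

(* Values and transition maps of a diagram at None are zero, so that a partial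
   map of posets f : Q -> option P pulls diagrams on P back to diagrams on Q,
   extended by zero. *)
Section PartialPullback.
Variables (d : Order.disp_t) (P : porderType d) (A : abelian_category).
Notation AP := (functor_category P A).
Implicit Types (K L : AP) (o : option P).

Definition oval K o : A := if o is Some p then K p else zeroob A.

(** The order is decided inside, so that a transition exists for every pair, with default 0 when [p]
    is not below [p']. Thus no proof of [p <= p'] has to be carried along. *)
Definition otrans K o o' : phom (oval K o) (oval K o') :=
  match o, o' return phom (oval K o) (oval K o') with
  | Some p, Some p' =>
      match decP (@idP (p <= p')%O) with
      | left pp' => fmap K (pp' : hom (p : poset_category P) p')
      | right _ => 0
      end
  | _, _ => 0
  end.

Definition oval_map K L (s : phom K L) o : phom (oval K o) (oval L o) :=
  match o return phom (oval K o) (oval L o) with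
  | Some p => at_pt s p
  | None => 0
  end.

Lemma to_zeroob (x : A) (f : phom x (zeroob A)) : f = 0.
Proof. exact/to_zero/zeroobP. Qed.

Lemma otransE K (p p' : P) (pp' : hom (p : poset_category P) p') :
  otrans K (Some p) (Some p') = fmap K pp'.
Proof.
rewrite /otrans; case: decP => [h|/(_ pp')//].
by rewrite (bool_irrelevance h pp').
Qed.

Lemma otrans_id K o : otrans K o o = pid (oval K o).
Proof.
case: o => [p|]; last by rewrite /= zeroobP.
by rewrite (otransE K (lexx p)); exact: (@fmap1 (poset_category P) A K p).
Qed.

Lemma otrans_nat K L (s : phom K L) o o' :
  oval_map s o' \op otrans K o o' = otrans L o o' \op oval_map s o.
Proof.
case: o o' => [p|] [p'|]; rewrite /= ?pcomp0m ?pcompm0 //.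
by case: decP => [h|_]; [exact: (dm_nat s)|rewrite pcomp0m pcompm0].
Qed.

(** The condition under which transitions compose. With both ends defined, an undefined or misplaced
    middle would make the composite zero where K may have a nonzero map; with an end undefined, both
    sides vanish. *)
Definition obetween o o' o'' : bool :=
  match o, o'' with
  | Some p, Some p'' => if o' is Some p' then (p <= p' <= p'')%O else false
  | _, _ => true
  end.

Lemma otransM K o o' o'' : obetween o o' o'' ->
  otrans K o' o'' \op otrans K o o' = otrans K o o''.
Proof.
case: o o'' => [p|] [p''|].
- case: o' => [p'|] // /andP[h h'].
  rewrite (otransE K h) (otransE K h') (otransE K (le_trans h h')).
  exact/esym/(@fmapM (poset_category P) A K).
- by move=> _; apply: to_zeroob.
- by move=> _; rewrite pcompm0.
by move=> _; apply: to_zeroob.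
Qed.

Section Pull.
Variables (d' : Order.disp_t) (Q : porderType d') (f : Q -> option P).
Hypothesis fP : forall q q' q'', (q <= q')%O -> (q' <= q'')%O ->
  obetween (f q) (f q') (f q'').
Notation AQ := (functor_category Q A).

Definition pull K : AQ.
Proof.
exists (fun q => oval K (f q)) (fun q q' _ => otrans K (f q) (f q')) => [q|q q' q'' h h'].
  exact: otrans_id.
by apply/esym/otransM/fP.
Defined.

Definition pull_map K L (s : phom K L) : phom (pull K) (pull L).
Proof.
by exists (fun q => oval_map s (f q)) => q q' h; apply: otrans_nat.
Defined.

Lemma oval_map1 K o : oval_map (pid K) o = pid (oval K o).
Proof. by case: o => //=; rewrite zeroobP. Qed.

Lemma oval_mapM K L M (t : phom L M) (s : phom K L) o :
  oval_map (t \op s) o = oval_map t o \op oval_map s o.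
Proof. by case: o => //=; rewrite pcompm0. Qed.

Lemma oval_mapD K L (s t : phom K L) o : oval_map (s + t) o = oval_map s o + oval_map t o.
Proof. by case: o => //=; rewrite addr0. Qed.

Lemma pull_exact K L M (s : phom K L) (t : phom L M) :
  t \op s = 0 -> exact s t -> exact (pull_map s) (pull_map t).
Proof.
move=> ts0 /(fexactP ts0) st; apply/fexactP.
  apply: at_pt_ext => q; rewrite /at_pt /= -oval_mapM ts0.
  by case: (f q).
move=> q; rewrite /at_pt /=; case: (f q) => [p|] /=; first exact: st.
move=> w a _; exists w, (pid w), 0; split; first exact: epi_pid.
by rewrite pcompm0; apply: to_zeroob.
Qed.

Definition pull_functor : exact_functor AP AQ.
Proof.
exists pull pull_map.
- by move=> K; apply: at_pt_ext => q; apply: oval_map1.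
- by move=> K L M t s; apply: at_pt_ext => q; apply: oval_mapM.
- by move=> K L t s; apply: at_pt_ext => q; apply: oval_mapD.
- exact: pull_exact.
Defined.

End Pull.
End PartialPullback.
Arguments otrans : simpl never.

Section PullTransformation.
Variables (d d' : Order.disp_t) (P : porderType d) (Q : porderType d').
Variables (A : abelian_category) (f g : Q -> option P).
Hypothesis fP : forall q q' q'', (q <= q')%O -> (q' <= q'')%O ->
  obetween (f q) (f q') (f q'').
Hypothesis gP : forall q q' q'', (q <= q')%O -> (q' <= q'')%O ->
  obetween (g q) (g q') (g q'').
Hypothesis fgP : forall q q', (q <= q')%O ->
  obetween (f q) (f q') (g q') && obetween (f q) (g q) (g q').

(** By [fgP], both composites in the naturality square equal the direct transition from [f q] to
    [g q']. *)
Definition pull_trans_app (K : functor_category P A) :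
  phom (pull_functor A fP K) (pull_functor A gP K).
Proof.
exists (fun q => otrans K (f q) (g q)) => q q' qq' /=.
by have /andP[h h'] := fgP qq'; rewrite !otransM.
Defined.

Definition pull_trans : exact_trans (pull_functor A fP) (pull_functor A gP).
Proof.
exists pull_trans_app => K L s.
by apply: at_pt_ext => q; apply/esym/otrans_nat.
Defined.

End PullTransformation.

(** * The index maps, units and counits for the two ordinal sums *)

Section OrdinalSums.
Variables (d : Order.disp_t) (X : finPOrderType d) (A : abelian_category).
Notation P := (ordinal_sum X one_poset).
Notation Q := (ordinal_sum one_poset X).
Notation AP := (functor_category P A).
Notation AQ := (functor_category Q A).

Definition top : P := inr ord0.
Definition bot : Q := inl ord0.

Lemma le_top (p : P) : (p <= top)%O.
Proof. by case: p => // i; rewrite (ord1 i). Qed.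

Lemma le_bot (q : Q) : (bot <= q)%O.
Proof. by case: q => // i; rewrite (ord1 i). Qed.

(* A diagram on P is K = (F -> M) and one on Q is L = (N -> G), with F and G
   diagrams on X. The indices give U K = (0 -> F), V K = (M -> M),
   U' L = (N -> N), V' L = (G -> 0), M and N standing also for constant diagrams.
   So Cone(U K -> V K) = (M -> Cone(F -> M)) up to isomorphism, and
   Cone(U' L -> V' L) = (Cone(N -> G) -> N[1]). *)
Definition uidx (q : Q) : option P := if q is inr x then Some (inl x) else None.
Definition vidx (q : Q) : option P := Some top.
Definition uidx' (p : P) : option Q := Some bot.
Definition vidx' (p : P) : option Q := if p is inl x then Some (inr x) else None.

Lemma uidxP q q' q'' : (q <= q')%O -> (q' <= q'')%O ->
  obetween (uidx q) (uidx q') (uidx q'').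
Proof. by case: q q' q'' => [i|x] [i'|x'] [i''|x''] //= h h'; apply/andP. Qed.

Lemma vidxP q q' q'' : (q <= q')%O -> (q' <= q'')%O ->
  obetween (vidx q) (vidx q') (vidx q'').
Proof. by rewrite /= lexx. Qed.

Lemma uidx'P p p' p'' : (p <= p')%O -> (p' <= p'')%O ->
  obetween (uidx' p) (uidx' p') (uidx' p'').
Proof. by rewrite /= lexx. Qed.

Lemma vidx'P p p' p'' : (p <= p')%O -> (p' <= p'')%O ->
  obetween (vidx' p) (vidx' p') (vidx' p'').
Proof. by case: p p' p'' => [x|i] [x'|i'] [x''|i''] //= h h'; apply/andP. Qed.

Lemma tauP q q' : (q <= q')%O ->
  obetween (uidx q) (uidx q') (vidx q') && obetween (uidx q) (vidx q) (vidx q').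
Proof. by case: q q' => [i|x] [i'|x'] //= h; rewrite !le_top !andbT. Qed.

Lemma tau'P p p' : (p <= p')%O ->
  obetween (uidx' p) (uidx' p') (vidx' p') && obetween (uidx' p) (vidx' p) (vidx' p').
Proof. by case: p p' => [x|i] [x'|i'] //= h; rewrite !le_bot. Qed.

Definition Ux := pull_functor A uidxP.
Definition Vx := pull_functor A vidxP.
Definition Ux' := pull_functor A uidx'P.
Definition Vx' := pull_functor A vidx'P.
Definition tau := pull_trans A uidxP vidxP tauP.
Definition tau' := pull_trans A uidx'P vidx'P tau'P.

Lemma Ux'_Ux0 (K : AP) : pid (Ux' (Ux K)) = 0.
Proof. by apply: at_pt_ext => p; apply: zeroobP. Qed.

Lemma Vx_Vx'0 (L : AQ) : pid (Vx (Vx' L)) = 0.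
Proof. by apply: at_pt_ext => p; apply: zeroobP. Qed.

(** The map (F -> M) -> (M -> M), with the sign that makes the two paths to V'V K cancel in
    [unit0]. *)
Definition unit_top (K : AP) : phom K (Ux' (Vx K)).
Proof.
exists (fun p => - (otrans K (Some p) (Some top))) => p q h /=.
rewrite otrans_id pcomp1m pcompNm -(otransE K h); congr (- _).
have hb : obetween (Some p) (Some q) (Some top) by rewrite /= le_top andbT.
exact: (otransM K hb).
Defined.

Definition unit_part_pt (K : AP) (p : P) : phom (K p : A) (oval (Ux K) (vidx' p)) :=
  match p return phom (K p : A) (oval (Ux K) (vidx' p)) with
  | inl x => pid (K (inl x) : A)
  | inr _ => 0
  end.

Definition unit_part (K : AP) : phom K (Vx' (Ux K)).
Proof.
exists (unit_part_pt K) => - [x|i] [x'|i'] h //.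
- rewrite [LHS]pcomp1m [RHS]pcompm1; apply: esym.
  exact: (etrans (otransE (Ux K) (p := inr x) (p' := inr x') h) (otransE K h)).
- by rewrite [LHS]pcomp0m [RHS]pcomp0m.
by rewrite [LHS]pcomp0m [RHS]pcompm0.
Defined.

Definition counit_bot (L : AQ) : phom (Vx (Ux' L)) L.
Proof.
exists (fun q => otrans L (Some bot) (Some q)) => q q' h /=.
rewrite otrans_id pcompm1 -(otransE L h); apply: esym.
have hb : obetween (Some bot) (Some q) (Some q') by rewrite /= le_bot.
exact: (otransM L hb).
Defined.

(** The components of the inclusion of (0 -> G) into (N -> G). *)
Definition counit_part_pt (L : AQ) (q : Q) : phom (oval (Vx' L) (uidx q)) (L q : A) :=
  match q return phom (oval (Vx' L) (uidx q)) (L q : A) with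
  | inl _ => 0
  | inr x => pid (L (inr x) : A)
  end.

Definition counit_part (L : AQ) : phom (Ux (Vx' L)) L.
Proof.
exists (counit_part_pt L) => - [i|x] [i'|x'] h //.
- by rewrite [LHS]pcomp0m [RHS]pcompm0.
- by rewrite [LHS]pcompm0 [RHS]pcompm0.
rewrite [LHS]pcomp1m [RHS]pcompm1.
exact: (etrans (otransE (Vx' L) (p := inl x) (p' := inl x') h) (otransE L h)).
Defined.

Lemma unit_top_nat (K L : AP) (f : phom K L) :
  unit_top L \op f = emap Ux' (emap Vx f) \op unit_top K.
Proof.
apply: at_pt_ext => p.
have e := otrans_nat f (Some p) (Some top).
exact: (etrans (pcompNm _ _) (etrans (congr1 -%R (esym e)) (esym (pcompmN _ _)))).
Qed.

Lemma unit_part_nat (K L : AP) (f : phom K L) :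
  unit_part L \op f = emap Vx' (emap Ux f) \op unit_part K.
Proof.
apply: at_pt_ext => -[x|i].
  exact: etrans (pcomp1m _) (esym (pcompm1 _)).
exact: etrans (pcomp0m _ _) (esym (pcomp0m _ _)).
Qed.

Lemma counit_bot_nat (K L : AQ) (f : phom K L) :
  f \op counit_bot K = counit_bot L \op emap Vx (emap Ux' f).
Proof. by apply: at_pt_ext => q; exact: (otrans_nat f (Some bot) (Some q)). Qed.

Lemma counit_part_nat (K L : AQ) (f : phom K L) :
  f \op counit_part K = counit_part L \op emap Ux (emap Vx' f).
Proof.
apply: at_pt_ext => -[i|x].
  exact: etrans (pcompm0 _ _) (esym (pcompm0 _ _)).
exact: etrans (pcompm1 _) (esym (pcomp1m _)).
Qed.

(** The unit sequence at a point of X, with [f] the map F x -> M. At the top element it has the form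
    of [zero_right_exact]. For the counit, [opgraph_exact] and [zero_left_exact] play these roles at
    points of X and at the bottom element. *)
Lemma graph_exact (x y : A) (f : phom x y) :
  short_exact (cpair (- f) (pid x)) (pid y \op prl_ y x + f \op prr_ y x).
Proof.
apply: (short_exact_split (r := prr_ y x) (s := inl_ y x)).
- by rewrite pcompDl -!pcompA prl_cpair prr_cpair pcomp1m pcompm1 addNr.
- exact: prr_cpair.
- by rewrite pcompDl -!pcompA prl_inl prr_inl pcomp1m pcompm0 addr0.
apply: biprod_elt => w a b; rewrite pcompDl -!pcompA pcompDl -!pcompA prl_cpair prr_cpair.
by rewrite cpair_comp inl_cpair cpairD !pcomp1m pcompNm addr0 [- _ + _]addrC addrK.
Qed.

Lemma opgraph_exact (x y : A) (f : phom x y) :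
  short_exact (cpair (pid x) (- f)) (f \op prl_ x y + pid y \op prr_ x y).
Proof.
apply: (short_exact_split (r := prl_ x y) (s := inr_ x y)).
- by rewrite pcompDl -!pcompA prl_cpair prr_cpair pcomp1m pcompm1 subrr.
- exact: prl_cpair.
- by rewrite pcompDl -!pcompA prl_inr prr_inr pcomp1m pcompm0 add0r.
apply: biprod_elt => w a b; rewrite pcompDl -!pcompA pcompDl -!pcompA prl_cpair prr_cpair.
by rewrite cpair_comp inr_cpair cpairD !pcomp1m pcompNm addr0 addKr.
Qed.

Lemma zero_right_exact (x : A) (u : phom x (zeroob A))
    (g : phom (biprod x (zeroob A)) (zeroob A)) :
  short_exact (cpair (- pid x) u) g.
Proof.
apply: (short_exact_split (r := - prl_ _ _) (s := 0)).
- exact: to_zeroob.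
- by rewrite pcompNm prl_cpair opprK.
- by rewrite zeroobP pcompm0.
apply: biprod_ext_pr; last by rewrite [LHS]to_zeroob [RHS]to_zeroob.
by rewrite pcomp0m addr0 pcompA prl_cpair pcompNm pcomp1m opprK pcompm1.
Qed.

Lemma zero_left_exact (x : A) (f : phom (zeroob A) (biprod x (zeroob A)))
    (u : phom (zeroob A) x) :
  short_exact f (pid x \op prl_ _ _ + u \op prr_ _ _).
Proof.
have from0 (y : A) (v : phom (zeroob A) y) : v = 0.
  by rewrite -[v]pcompm1 zeroobP pcompm0.
apply: (short_exact_split (r := 0) (s := inl_ _ _)).
- by rewrite [LHS]from0.
- by rewrite zeroobP pcomp0m.
- by rewrite (from0 _ u) pcomp1m pcomp0m addr0 prl_inl.
apply: biprod_ext_pr; last by rewrite [LHS]to_zeroob [RHS]to_zeroob.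
rewrite (from0 _ u) pcompm0 add0r pcomp1m pcomp0m addr0 pcompA prl_inl.
by rewrite pcomp1m pcompm1.
Qed.

Lemma unit_exact (K : AP) : short_exact (cpair (unit_top K) (unit_part K))
  (tau' (Vx K) \op prl_ _ _ + emap Vx' (tau K) \op prr_ _ _).
Proof.
apply: fshort_exact => -[x|i].
  have e : otrans (Vx K) (Some bot) (Some (inr x)) = pid (K top : A).
    rewrite (otransE (Vx K) (le_bot (inr x))); exact: (otrans_id K (Some top)).
  (* The sequence at [inl x] is convertible to this one once its identity of M is written as the
     transition in [e]. *)
  have := graph_exact (otrans K (Some (inl x)) (Some top)).
  by rewrite -e.
rewrite (ord1 i).
have := zero_right_exact 0
  (at_pt (tau' (Vx K) \op prl_ _ _ + emap Vx' (tau K) \op prr_ _ _) top).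
by rewrite -(otrans_id K (Some top)).
Qed.

Lemma counit_exact (L : AQ) : short_exact (cpair (tau (Ux' L)) (- emap Ux (tau' L)))
  (counit_bot L \op prl_ _ _ + counit_part L \op prr_ _ _).
Proof.
apply: fshort_exact => -[i|x].
  rewrite (ord1 i).
  have := zero_left_exact (at_pt (cpair (tau (Ux' L)) (- emap Ux (tau' L))) bot) 0.
  by rewrite -(otrans_id L (Some bot)).
have e : otrans (Ux' L) (Some (inl x)) (Some top) = pid (L bot : A).
  rewrite (otransE (Ux' L) (le_top (inl x))); exact: (otrans_id L (Some bot)).
have := opgraph_exact (otrans L (Some bot) (Some (inr x))).
by rewrite -e.
Qed.

End OrdinalSums.

Theorem corollary1p5 (d : Order.disp_t) (X : finPOrderType d) :
  universally_derived_equivalent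
    (ordinal_sum X one_poset) (ordinal_sum one_poset X).
Proof.
move=> A; exists (scone_triangulated (tau X A)).
exact: (scone_equivalence (@Ux'_Ux0 _ _ _) (@Vx_Vx'0 _ _ _) (@unit_top_nat _ _ _)
  (@unit_part_nat _ _ _) (@unit_exact _ _ _) (@counit_bot_nat _ _ _) (@counit_part_nat _ _ _)
  (@counit_exact _ _ _)).
Qed.
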